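(* There exists a finite tile set $T$ such that for every integer $k\ge 7$ there exists a nondecreasing temperature function $\tau_k:\mathbb{N}\to\mathbb{N}$ for which the size-dependent system $(T,\tau_k)$ self-assembles a $k\times k$ square.
   Context: Size-dependent two-handed tile assembly model. A tile type is a quadruple $(g_N,g_E,g_S,g_W)$ of glues from an alphabet $\Sigma$, each glue $g$ having a non-negative integer strength $\mathrm{str}(g)$. A tile is a unit square centered at a point of $\mathbb{Z}^2$ labeled by a tile type; two tiles are adjacent if their centers are at distance 1. An assembly is a partial map $\alpha:\mathbb{Z}^2\to T$ with finite domain $\mathrm{dom}(\alpha)$. Two adjacent tiles form a bond if the glues on their abutting edges are equal and of positive strength; the strength of the bond is that glue's strength. The bond graph of $\alpha$ has vertex set $\mathrm{dom}(\alpha)$ and an edge for each bond. A cut of an assembly is an edge cut of its bond graph (a partition of $\mathrm{dom}(\alpha)$ into two nonempty parts), and its strength is the total strength of bonds crossing it. A supertile $\tilde\alpha$ is the equivalence class of an assembly under translation; its size $|\tilde\alpha|$ is the number of tiles of an assembly in it. A size-dependent system is a pair $(T,\tau)$ with $T$ a finite tile set and $\tau:\mathbb{N}\to\mathbb{N}$ a nondecreasing temperature function. An assembly $\gamma$ is $\tau$-stable if every cut partitioning $\mathrm{dom}(\gamma)$ into parts $\alpha,\beta$ has strength at least $\tau(\min(|\alpha|,|\beta|))$. Two supertiles $\tilde\alpha,\tilde\beta$ can combine into $\tilde\gamma$ if there are disjoint assemblies $\alpha\in\tilde\alpha$, $\beta\in\tilde\beta$ with $\alpha\cup\beta=\gamma\in\tilde\gamma$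 and the cut separating $\mathrm{dom}(\alpha)$ from $\mathrm{dom}(\beta)$ has strength at least $\tau(\min(|\alpha|,|\beta|))$. A supertile $\tilde\gamma$ can break into $\tilde\alpha,\tilde\beta$ if there are disjoint assemblies $\alpha\in\tilde\alpha,\beta\in\tilde\beta$ with connected bond graphs, $\alpha\cup\beta=\gamma\in\tilde\gamma$, and the cut separating them has strength less than $\tau(\min(|\alpha|,|\beta|))$. A supertile is producible if it is a single tile of a type in $T$, a combination of two producible supertiles, or a result of a break of a producible supertile. A producible supertile is terminal if it can combine with no producible supertile and cannot break. The system self-assembles a shape $P\subseteq\mathbb{Z}^2$ if every terminal supertile has an assembly whose domain is exactly $P$ (and, implicitly, a terminal supertile exists). A $k\times k$ square is a set $\{x+1,\dots,x+k\}\times\{y+1,\dots,y+k\}$ for some integers $x,y$. *)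

(* Defs.v *)
From HB Require Import structures.
From mathcomp Require Import all_boot all_order all_algebra.
Set Implicit Arguments. Unset Strict Implicit. Unset Printing Implicit Defensive.
Import Order.TTheory GRing.Theory Num.Theory.

Definition glue := nat.

Definition tiletype := (glue * glue * glue * glue)%type.
Definition gN (t : tiletype) : glue := t.1.1.1.
Definition gE (t : tiletype) : glue := t.1.1.2.
Definition gS (t : tiletype) : glue := t.1.2.
Definition gW (t : tiletype) : glue := t.2.

Definition pos := (int * int)%type.

(* An assembly: a finite list of placed tiles with pairwise distinct positions
   (well-formedness "wf"); it represents the partial map Z^2 -> T. *)
Definition assembly := seq (pos * tiletype).
Definition wf (a : assembly) : bool := uniq (map fst a).
Definition dom (a : assembly) : seq pos := map fst a.

Definition bstr (str : glue -> nat) (x y : pos * tiletype) : nat :=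
  let: (p, t) := x in let: (q, u) := y in
  if (q.1 == p.1 + 1)%R && (q.2 == p.2) then (if gE t == gW u then str (gE t) else 0)
  else if (q.1 + 1 == p.1)%R && (q.2 == p.2) then (if gW t == gE u then str (gW t) else 0)
  else if (q.1 == p.1) && (q.2 == p.2 + 1)%R then (if gN t == gS u then str (gN t) else 0)
  else if (q.1 == p.1) && (q.2 + 1 == p.2)%R then (if gS t == gN u then str (gS t) else 0)
  else 0.

Definition cut_str (str : glue -> nat) (a b : assembly) : nat :=
  \sum_(x <- a) \sum_(y <- b) bstr str x y.

Definition union_of (gam a b : assembly) : Prop :=
  perm_eq gam (a ++ b) /\ wf gam.

Definition connected (str : glue -> nat) (a : assembly) : Prop :=
  forall x y, x \in a -> y \in a ->
    exists s : seq (pos * tiletype),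
      path (fun u v => (v \in a) && (0 < bstr str u v)) x s /\ last x s = y.

(* Producible assemblies of the system (T, tau). A supertile is producible iff
   (any / every) assembly representing it is producible; the rules below are
   translation invariant, so producibility is closed under translation. *)
Inductive producible (str : glue -> nat) (T : seq tiletype) (tau : nat -> nat)
  : assembly -> Prop :=
| prod_tile (t : tiletype) (p : pos) :
    t \in T -> producible str T tau [:: (p, t)]
| prod_comb (a b g : assembly) :
    producible str T tau a -> producible str T tau b -> union_of g a b ->
    tau (minn (size a) (size b)) <= cut_str str a b ->
    producible str T tau g
| prod_break (g a b : assembly) :
    producible str T tau g -> union_of g a b ->
    a != [::] -> b != [::] -> connected str a -> connected str b ->
    cut_str str a b < tau (minn (size a) (size b)) ->
    producible str T tau a.

Definition can_break (str : glue -> nat) (tau : nat -> nat) (g : assembly) : Prop :=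
  exists a b, union_of g a b /\ a != [::] /\ b != [::] /\
    connected str a /\ connected str b /\
    cut_str str a b < tau (minn (size a) (size b)).

(* g can combine with the producible d (placed at some translation, which is
   covered since producible assemblies are closed under translation). *)
Definition can_combine_with (str : glue -> nat) (tau : nat -> nat) (g d : assembly) : Prop :=
  wf (g ++ d) /\ tau (minn (size g) (size d)) <= cut_str str g d.

Definition terminal (str : glue -> nat) (T : seq tiletype) (tau : nat -> nat)
    (g : assembly) : Prop :=
  producible str T tau g /\
  (forall d, producible str T tau d -> ~ can_combine_with str tau g d) /\
  ~ can_break str tau g.

Definition self_assembles (str : glue -> nat) (T : seq tiletype) (tau : nat -> nat)
    (P : pred pos) : Prop :=
  (exists g, terminal str T tau g) /\
  forall g, terminal str T tau g ->
    exists v : pos, forall p : pos,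
      (p \in dom g) = P ((p.1 + v.1)%R, (p.2 + v.2)%R).

Definition square (k : nat) (x y : int) : pred pos :=
  fun p => ((x < p.1)%R && (p.1 <= x + k%:Z)%R) && ((y < p.2)%R && (p.2 <= y + k%:Z)%R).

Definition nondecreasing_fun (tau : nat -> nat) : Prop :=
  forall m n, m <= n -> tau m <= tau n.

(* Main.v *)
(* Idea. All tiles but those of the "bar" form a comb: a corner SW, a spine going
   north from SW to NW, a bottom row going east from SW to SE, rows of tiles C
   hanging on the spine, and a column of tiles F ending with NE hanging on SE.
   Growth of a row or column is only stopped by what stands in its way, so an
   assembly to which no single tile attaches is a full rectangle: its extremal tiles
   must be the four corners, and non-backtracking walks show that a connected comb
   has at most one corner of each kind (the hair H, I starting west of NE rules out
   columns F sticking out above the rows).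
   For a (n+1) x (m+1) rectangle the rows hang by strength 4 and the column F by
   strength 5, so that the jumps of the temperature at k-1 and k break off rows if
   n >= k and the column if m >= k, whereas all other bonds have strength 7, the
   maximal temperature.  Small rectangles are never terminal, because an L-shaped bar
   of n+m+3 tiles running along the west and north sides can attach by two "feet" of
   strength 3 as long as its size is at most 2k; for the k x k square a bar needs
   2k+1 tiles, and there the temperature is 7.  A bar is not terminal either since a
   hair G can always grow at its corner Q.  Finally no bar ever links two combs: a
   single foot is too weak to attach, so in a producible assembly both feet of a bar
   are bonded to the same comb, and this survives breaks because a cut of strength at
   most 6 cannot contain a foot and another bond of strength at least 4. *)

From HB Require Import structures.
Require Import Defs.
From mathcomp Require Import all_boot all_order all_algebra.
From mathcomp Require Import zify.
Import Order.TTheory GRing.Theory Num.Theory.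
Set Implicit Arguments. Unset Strict Implicit. Unset Printing Implicit Defensive.

(** * Bond graphs and cuts *)

Notation ptile := (pos * tiletype)%type.

Inductive dir := dE | dW | dN | dS.

Definition opp d := match d with dE => dW | dW => dE | dN => dS | dS => dN end.

Definition mv d (p : pos) : pos :=
  match d with
  | dE => (p.1 + 1, p.2)%R
  | dW => (p.1 - 1, p.2)%R
  | dN => (p.1, p.2 + 1)%R
  | dS => (p.1, p.2 - 1)%R
  end.

Definition gl d (t : tiletype) : glue :=
  match d with dE => gE t | dW => gW t | dN => gN t | dS => gS t end.

Definition dir_eqb d e :=
  match d, e with dE, dE | dW, dW | dN, dN | dS, dS => true | _, _ => false end.

Lemma dir_eqP : Equality.axiom dir_eqb.
Proof. by case=> [] []; constructor. Qed.

HB.instance Definition _ := hasDecEq.Build dir dir_eqP.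

Lemma mv_oppK d p : mv (opp d) (mv d p) = p.
Proof. by case: d p => [] [x y] /=; congr pair; lia. Qed.

Lemma oppK : involutive opp.
Proof. by case. Qed.

Section Bonds.
Variable str : glue -> nat.
Implicit Types (A B G X Y : assembly) (u v w x y r : ptile).

Lemma bstr_mv d u v : v.1 = mv d u.1 ->
  bstr str u v = if gl d u.2 == gl (opp d) v.2 then str (gl d u.2) else 0.
Proof.
case: u v => [[a b] t] [q w] /= ->; rewrite /bstr.
case: d => /=.
- by rewrite !eqxx.
- rewrite (_ : (a - 1 == a + 1)%R = false) /=; last lia.
  by rewrite (_ : (a - 1 + 1 == a)%R) ?eqxx //; lia.
- rewrite (_ : (a == a + 1)%R = false) /=; last lia.
  rewrite (_ : (a + 1 == a)%R = false) /=; last lia.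
  by rewrite !eqxx.
- rewrite (_ : (a == a + 1)%R = false) /=; last lia.
  rewrite (_ : (a + 1 == a)%R = false) /=; last lia.
  rewrite eqxx /= (_ : (b - 1 == b + 1)%R = false) /=; last lia.
  by rewrite (_ : (b - 1 + 1 == b)%R) //; lia.
Qed.

Lemma bstr_dir u v : 0 < bstr str u v ->
  exists d, [/\ v.1 = mv d u.1, gl d u.2 = gl (opp d) v.2,
    0 < str (gl d u.2) & bstr str u v = str (gl d u.2)].
Proof.
move=> h; suff [d e]: exists d, v.1 = mv d u.1.
  by exists d; move: h; rewrite (bstr_mv e); case: eqP.
move: h; case: u v => [[a b] t] [[c d] w]; rewrite /bstr /=.
case: ifP => [/andP[/eqP-> /eqP->] _|_]; first by exists dE.
case: ifP => [/andP[/eqP<- /eqP->] _|_].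
  by exists dW => /=; congr pair; lia.
case: ifP => [/andP[/eqP-> /eqP->] _|_]; first by exists dN.
case: ifP => [/andP[/eqP-> /eqP<-] _|//].
by exists dS => /=; congr pair; lia.
Qed.

Lemma bstr_sym u v : bstr str u v = bstr str v u.
Proof.
wlog h : u v / 0 < bstr str u v.
  move=> hw; case: (posnP (bstr str u v)) => [e|/hw//].
  by case: (posnP (bstr str v u)) => [->|/hw<-].
have [d [e g _ s]] := bstr_dir h.
have e' : u.1 = mv (opp d) v.1 by rewrite e mv_oppK.
by rewrite s (bstr_mv e') oppK -g eqxx.
Qed.

(** * Reachability and connected assemblies *)

Definition reach A u v :=
  exists s : seq ptile,
    path (fun u v => (v \in A) && (0 < bstr str u v)) u s /\ last u s = v.

Lemma reach_refl A u : reach A u u.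
Proof. by exists [::]. Qed.

Lemma reach_trans A u v w : reach A u v -> reach A v w -> reach A u w.
Proof.
move=> [s [ps ls]] [s' [ps' ls']]; exists (s ++ s').
by rewrite cat_path ps ls ps' last_cat ls ls'.
Qed.

Lemma reach_step A u v : v \in A -> 0 < bstr str u v -> reach A u v.
Proof. by move=> vA h; exists [:: v]; rewrite /= vA h. Qed.

Lemma reach_ind A (P : ptile -> Prop) u v : reach A u v -> u \in A -> P u ->
  (forall x y, x \in A -> y \in A -> P x -> 0 < bstr str x y -> P y) -> P v.
Proof.
move=> [s [ps <-]] + + H; elim: s u ps => //= y s IH x /andP[/andP[yA b] ps] xA Px.
by apply: IH => //; apply: H b.
Qed.

Lemma reach_sym A u v : u \in A -> reach A u v -> reach A v u.
Proof.
move=> uA h; apply: (reach_ind (P := fun x => reach A x u) h uA (reach_refl _ _)) => x y xA yA r b.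
by apply: reach_trans r; apply: reach_step => //; rewrite bstr_sym.
Qed.

Lemma connected_root A r : (forall v, v \in A -> reach A r v) -> r \in A ->
  connected str A.
Proof.
move=> H rA x y xA yA; apply: reach_trans (H y yA).
by apply: reach_sym => //; apply: H.
Qed.

(** Descending along bonds to smaller ranks must end at [r]. The explicit assemblies (broken-off
    rows and columns, bars, squares) are shown connected in this way. *)
Lemma connected_rank A r (rk : ptile -> nat) : r \in A ->
  (forall v, v \in A -> v = r \/
     exists u, [/\ u \in A, rk u < rk v & 0 < bstr str u v]) ->
  connected str A.
Proof.
move=> rA H; apply: (connected_root (r := r)) => // v.
have [n] := ubnP (rk v); elim: n v => // n IH v hn vA.
have [->|[u [uA lt b]]] := H v vA; first exact: reach_refl.
apply: reach_trans (IH u _ uA) _; first exact: leq_trans lt _.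
exact: reach_step.
Qed.

Lemma connected_eq_mem A B : A =i B -> connected str A -> connected str B.
Proof.
move=> e c x y; rewrite -!e => xA yA.
apply: (reach_ind (P := reach B x) (c x y xA yA) xA); first exact: reach_refl.
by move=> u v uA vA r b; apply: reach_trans r _; apply: reach_step; rewrite -?e.
Qed.

Lemma wf_inj A u v : wf A -> u \in A -> v \in A -> u.1 = v.1 -> u = v.
Proof.
elim: A => // a A IH; rewrite /wf /= => /andP[/mapP h w]; rewrite !inE.
case/predU1P=> [->|uA]; case/predU1P=> [->|vA] // e; last exact: IH.
- by case: h; exists v.
- by case: h; exists u.
Qed.

(** * Splitting an assembly into two pieces *)

Lemma union_mem G A B : union_of G A B -> G =i A ++ B.
Proof. by case=> /perm_mem. Qed.

Lemma union_memL G A B u : union_of G A B -> u \in A -> u \in G.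
Proof. by move/union_mem=> -> uA; rewrite mem_cat uA. Qed.

Lemma union_memR G A B u : union_of G A B -> u \in B -> u \in G.
Proof. by move/union_mem=> -> uA; rewrite mem_cat uA orbT. Qed.

Lemma union_sym G A B : union_of G A B -> union_of G B A.
Proof. by case=> p w; split=> //; rewrite (perm_trans p) // perm_catC. Qed.

Lemma union_wfL G A B : union_of G A B -> wf A.
Proof.
case=> p; rewrite /wf (perm_uniq (perm_map fst p)) map_cat cat_uniq.
by case/and3P.
Qed.

Lemma union_wfR G A B : union_of G A B -> wf B.
Proof. by move/union_sym/union_wfL. Qed.

Lemma union_disj G A B u v : union_of G A B -> u \in A -> v \in B -> u.1 <> v.1.
Proof.
case=> p; rewrite /wf (perm_uniq (perm_map fst p)) map_cat cat_uniq.
case/and3P=> _ /hasPn h _ uA vB e.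
by have := h _ (map_f fst vB); rewrite /= -e map_f.
Qed.

Lemma union_size G A B : union_of G A B -> size G = size A + size B.
Proof. by case=> /perm_size -> _; rewrite size_cat. Qed.

Lemma union_filter (p : pred ptile) G A B : union_of G A B ->
  union_of (filter p G) (filter p A) (filter p B).
Proof.
case=> pe w; split; first by rewrite -filter_cat perm_filter.
by apply: subseq_uniq w; apply: map_subseq; apply: filter_subseq.
Qed.

Lemma union_filterC (p : pred ptile) G : wf G ->
  union_of G (filter (predC p) G) (filter p G).
Proof. by move=> w; split=> //; rewrite perm_sym (perm_trans _ (permEl (perm_filterC p G))) // perm_catC. Qed.

Lemma wf_uniq A : wf A -> uniq A.
Proof. exact: map_uniq. Qed.

Lemma connected_cross G A B : connected str G -> union_of G A B ->
  A != [::] -> B != [::] -> exists u v, [/\ u \in A, v \in B & 0 < bstr str u v].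
Proof.
move=> c U; case: A U => // a A; case: B => // b B U _ _.
have aG : a \in G by apply: union_memL U _; rewrite mem_head.
have bG : b \in G by apply: union_memR U _; rewrite mem_head.
pose Q := exists u v, [/\ u \in a :: A, v \in b :: B & 0 < bstr str u v].
have [bA|//] : b \in a :: A \/ Q.
  apply: (reach_ind (P := fun x => x \in a :: A \/ Q) (c a b aG bG) aG).
    by left; rewrite mem_head.
  move=> x y xG yG [xB|]; last by right.
  have := yG; rewrite (union_mem U) mem_cat => /orP[yA|yB] h; first by left.
  by right; exists x, y.
by case: (union_disj U bA (mem_head b B)).
Qed.

Lemma connected_union G A B u v : union_of G A B -> connected str A ->
  connected str B -> u \in A -> v \in B -> 0 < bstr str u v -> connected str G.
Proof.
move=> U cA cB uA vB h.
have up C x y : {subset C <= G} -> connected str C -> x \in C -> y \in C -> reach G x y.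
  move=> sC cC xC yC; apply: (reach_ind (P := reach G x) (cC x y xC yC) xC).
    exact: reach_refl.
  by move=> x' y' x'C y'C r b; apply: reach_trans r _; apply: reach_step => //; apply: sC.
have sA : {subset A <= G} by move=> x; apply: union_memL U.
have sB : {subset B <= G} by move=> x; apply: union_memR U.
apply: (connected_root (r := u)); last exact: sA.
move=> w; rewrite (union_mem U) mem_cat => /orP[wA|wB]; first exact: (up A).
apply: reach_trans (reach_step (sB _ vB) h) _.
exact: (up B).
Qed.

(* Contract B to the unique tile of A that touches it. *)
Lemma connected_leaf G A B u0 : connected str G -> union_of G A B ->
  (forall u v, u \in A -> v \in B -> 0 < bstr str u v -> u = u0) ->
  connected str A.
Proof.
move=> c U H x y xA yA.
have m z : z \in A -> z \in G by apply: union_memL U.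
(* Image of the path under the contraction: tiles outside [A] are sent to [u0], where every
   excursion into [B] starts and ends. *)
pose P z := if z \in A then reach A x z else reach A x u0.
suff : P y by rewrite /P yA.
apply: (reach_ind (P := P) (c x y (m _ xA) (m _ yA)) (m _ xA)).
  by rewrite /P xA; apply: reach_refl.
move=> u v uG vG; rewrite /P => Pu h.
have inB z : z \in G -> z \notin A -> z \in B.
  by rewrite (union_mem U) mem_cat => /orP[->|].
case: ifP Pu => uA Pu; case: ifP => vA //.
- by apply: reach_trans Pu _; apply: reach_step.
- by rewrite -(H u v) // inB // vA.
- have -> // : v = u0 by apply: (H v u) => //; rewrite ?inB ?uA // bstr_sym.
Qed.

(** * Upper and lower bounds on cut strengths *)

Lemma leq_sum_supp (T : eqType) (L E : seq T) (f : T -> nat) : uniq L ->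
  (forall e, e \in L -> 0 < f e -> e \in E) ->
  \sum_(e <- L) f e <= \sum_(e <- E) f e.
Proof.
elim: L E => [|a L IH] E /=; first by rewrite big_nil.
case/andP=> aL uL H; rewrite big_cons.
case: (posnP (f a)) => [->|fa].
  by apply: IH => // e eL; apply: H; rewrite inE eL orbT.
have aE : a \in E by apply: H; rewrite ?mem_head.
rewrite (perm_big _ (perm_to_rem aE)) big_cons leq_add2l; apply: IH => // e eL fe.
have : e \in E by apply: H => //; rewrite inE eL orbT.
rewrite (perm_mem (perm_to_rem aE)) inE => /orP[/eqP ea|//].
by rewrite -ea eL in aL.
Qed.

Lemma cut_strE X Y :
  cut_str str X Y = \sum_(e <- [seq (u, v) | u <- X, v <- Y]) bstr str e.1 e.2.
Proof. by rewrite /cut_str big_allpairs. Qed.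

Lemma cut_sym X Y : cut_str str X Y = cut_str str Y X.
Proof.
rewrite /cut_str exchange_big; apply: eq_bigr => u _; apply: eq_bigr => v _.
exact: bstr_sym.
Qed.

Lemma cut_ub X Y (E : seq (ptile * ptile)) : uniq X -> uniq Y ->
  (forall u v, u \in X -> v \in Y -> 0 < bstr str u v -> (u, v) \in E) ->
  cut_str str X Y <= \sum_(e <- E) bstr str e.1 e.2.
Proof.
move=> uX uY H; rewrite cut_strE; apply: leq_sum_supp.
  by apply: allpairs_uniq => // -[? ?] [? ?].
by move=> _ /allpairsP[[u v] [/= uu vv ->]]; apply: H.
Qed.

Lemma cut_lb X Y (E : seq (ptile * ptile)) : uniq E ->
  (forall e, e \in E -> (e.1 \in X) && (e.2 \in Y)) ->
  \sum_(e <- E) bstr str e.1 e.2 <= cut_str str X Y.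
Proof.
move=> uE H; rewrite cut_strE; apply: leq_sum_supp => // -[u v] /H /= /andP[uX vY] _.
exact: allpairs_f.
Qed.

Lemma cut_ge1 X Y u v : u \in X -> v \in Y -> bstr str u v <= cut_str str X Y.
Proof.
move=> uX vY; rewrite -[X in X <= _](big_seq1 addn (u, v) (fun e => bstr str e.1 e.2)).
by apply: cut_lb => // e; rewrite inE => /eqP ->; rewrite uX.
Qed.

Lemma cut_ge2 X Y u v u' v' : u \in X -> v \in Y -> u' \in X -> v' \in Y ->
  (u, v) != (u', v') -> bstr str u v + bstr str u' v' <= cut_str str X Y.
Proof.
move=> uX vY uX' vY' ne.
have := @cut_lb X Y [:: (u, v); (u', v')]; rewrite !big_cons big_nil addn0 /= => -> //.
  by rewrite inE ne.
by move=> e; rewrite !inE => /orP[] /eqP ->; rewrite ?uX ?uX' /=.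
Qed.

Lemma cut_pos X Y : 0 < cut_str str X Y ->
  exists u v, [/\ u \in X, v \in Y & 0 < bstr str u v].
Proof.
move=> h.
case: (boolP (has (fun u => has (fun v => 0 < bstr str u v) Y) X)).
  by case/hasP=> u uX /hasP[v vY b]; exists u, v.
move/hasPn=> H; move: h; rewrite /cut_str big_seq big1 // => u /H /hasPn K.
rewrite big_seq big1 // => v /K; lia.
Qed.

(* Walks without immediate backtracking, with the direction of the last step. *)
Inductive walk A r : dir -> ptile -> Prop :=
| walk_start d u : u \in A -> u.1 = mv d r.1 -> 0 < bstr str r u -> walk A r d u
| walk_step d u d' v : walk A r d u -> d' <> opp d -> v \in A ->
    v.1 = mv d' u.1 -> 0 < bstr str u v -> walk A r d' v.

Lemma walk_mem A r d u : walk A r d u -> u \in A.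
Proof. by case. Qed.

(** A step of a path that reverses the previous one returns to the tile before, because positions
    are distinct; the walk is then shortened by one step instead of being extended. *)
Lemma connected_walk A r : wf A -> connected str A -> r \in A ->
  forall v, v \in A -> v = r \/ exists d, walk A r d v.
Proof.
move=> w c rA v vA.
apply: (reach_ind (P := fun v => v = r \/ exists d, walk A r d v) (c r v rA vA) rA).
  by left.
move=> x y xA yA IH h; have [d [e _ _ _]] := bstr_dir h.
case: IH => [xr|[d' wx]].
  by right; exists d; rewrite xr in h e; apply: walk_start.
case: (eqVneq d (opp d')) => [dd|dd]; last first.
  by right; exists d; apply: walk_step (elimN eqP dd) _ _ h.
have ey : forall z : ptile, x.1 = mv d' z.1 -> y.1 = z.1 by move=> z ez; rewrite e ez dd mv_oppK.
case: {h} wx ey => [d1 u uA eu _|d1 u d2 u' wu _ _ eu _] ey.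
  by left; apply: (wf_inj w) => //; apply: ey.
right; exists d1; rewrite (wf_inj w yA (walk_mem wu)) //; exact: ey.
Qed.

Lemma walk_inv A r (R : dir -> ptile -> Prop) :
  (forall d u, u \in A -> u.1 = mv d r.1 -> 0 < bstr str r u -> R d u) ->
  (forall d u d' v, u \in A -> R d u -> d' <> opp d -> v \in A -> v.1 = mv d' u.1 ->
     0 < bstr str u v -> R d' v) ->
  forall d u, walk A r d u -> R d u.
Proof.
move=> H0 H1 d u; elim=> [{}d {}u|{}d {}u d' v wu] *; first exact: H0.
by apply: (H1 d u) => //; apply: walk_mem wu.
Qed.

(** Since immediate reversals are excluded, [R] may record the heading of the walk, and its
    preservation can be checked on tile types alone. *)
Lemma connected_inv A r (R : dir -> ptile -> Prop) : wf A -> connected str A -> r \in A ->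
  (forall d u, u \in A -> u.1 = mv d r.1 -> 0 < bstr str r u -> R d u) ->
  (forall d u d' v, u \in A -> R d u -> d' <> opp d -> v \in A -> v.1 = mv d' u.1 ->
     0 < bstr str u v -> R d' v) ->
  forall v, v \in A -> v = r \/ exists d, R d v.
Proof.
move=> w c rA H0 H1 v vA; have [->|[d wv]] := connected_walk w c rA vA; first by left.
by right; exists d; apply: walk_inv wv.
Qed.

(** Tiles are added one at a time: connectedness always offers a further tile bonded to the part
    already grown, and joining a single tile only requires strength [tau 1]. *)
Lemma connected_producible T tau A : wf A -> A != [::] -> {subset map snd A <= T} ->
  connected str A ->
  (forall u v, u \in A -> v \in A -> 0 < bstr str u v -> tau 1 <= bstr str u v) ->
  producible str T tau A.
Proof.
move=> w A0 sT c H.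
(* Producibility is claimed for every reordering of [S], because assemblies are lists and [A] has
   its own order. *)
suff K n : n < size A -> exists S, [/\ size S = n.+1, uniq S, {subset S <= A} &
    forall A', perm_eq A' S -> producible str T tau A'].
  have A1 : 0 < size A by rewrite lt0n size_eq0.
  have [|S [sS uS sub hS]] := K (size A).-1; first by rewrite prednK.
  rewrite prednK // in sS.
  have [|_ e] := uniq_min_size uS sub; first by rewrite sS.
  by apply: hS; apply: uniq_perm (wf_uniq w) uS _ => x; rewrite e.
elim: n => [|n IH] hn.
  case: A w A0 sT c H hn => // a A w _ sT c H _.
  exists [:: a]; split=> // [x|A' p]; first by rewrite !inE => ->.
  rewrite (perm_small_eq _ p) //.
  by case: a sT {w c H p} => q t sT; apply: prod_tile; apply: sT; rewrite mem_head.
have [S [sS uS sub hS]] := IH (ltnW hn).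
have U : union_of A S (filter (predC (mem S)) A).
  split=> //; rewrite -(perm_filterC (mem S) A) perm_cat2r.
  apply: uniq_perm => //; first by rewrite filter_uniq // wf_uniq.
  by move=> x; rewrite mem_filter; case xS: (x \in S); rewrite /= ?xS ?(sub _ xS).
have := connected_cross c U; case.
- by case: S sS {uS sub hS U}.
- apply/eqP=> e; have := union_size U; rewrite e sS /=; lia.
move=> u [v [uS' vS b]].
have vA := union_memR U vS; have uA := sub _ uS'.
have vS' : v \notin S by move: vS; rewrite mem_filter => /andP[].
exists (rcons S v); split.
- by rewrite size_rcons sS.
- by rewrite rcons_uniq vS'.
- by move=> x; rewrite mem_rcons inE => /orP[/eqP->|/sub].
move=> A' p; apply: (@prod_comb _ _ _ S [:: v]) => //.
- exact: hS.
- by case: v vA {b vS' p vS} => q t vA; apply: prod_tile; apply: sT; apply/mapP; exists (q, t).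
- split; first by rewrite cats1.
  rewrite /wf (perm_uniq (perm_map fst p)) map_rcons rcons_uniq.
  rewrite map_inj_in_uniq ?uS; last by move=> x y /sub xA /sub yA; apply: (wf_inj w).
  rewrite andbT; apply/mapP=> -[z zS e]; case/negP: vS'.
  by rewrite (wf_inj w vA (sub _ zS)).
- rewrite sS /= (minn_idPr _) //; apply: leq_trans (H u v uA vA b) _.
  by apply: cut_ge1; rewrite ?mem_head.
Qed.

(* Each bond changes p.1 + p.2 by one. *)
Lemma connected_size A u v n : connected str A -> u \in A -> v \in A ->
  (v.1.1 + v.1.2 = u.1.1 + u.1.2 + n%:Z)%R -> n < size A.
Proof.
move=> c uA vA e; have [s [ps ls]] := c u v uA vA.
(* Without repetitions, the path visits at most [size A] tiles. *)
case/shortenP: ps ls => s' ps' us' _ ls'.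
have sub : {subset u :: s' <= A}.
  move=> x; rewrite inE => /orP[/eqP->//|].
  elim: s' {us' ls'} u {uA e} ps' => //= y s' IH u /andP[/andP[yA _] ps'].
  by rewrite inE => /orP[/eqP->//|]; apply: IH ps'.
apply: leq_trans (uniq_leq_size us' sub) => /=; rewrite ltnS.
suff : (v.1.1 + v.1.2 <= u.1.1 + u.1.2 + (size s')%:Z)%R.
  by rewrite e lerD2l lez_nat.
rewrite -ls'; elim: s' {us' ls' sub e uA} u ps' => [|y s' IH] x /=; first by lia.
case/andP=> /andP[_ /bstr_dir[d [ey _ _ _]]] /IH; rewrite ey.
move: (last y s') (size s') => [[a b] t] n'; case: x {ey} => [[a' b'] t'].
by case: d => /=; lia.
Qed.

End Bonds.

(** * Extremal tiles and corners *)

Definition crd d (p : pos) : int :=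
  match d with dE => p.1 | dW => - p.1 | dN => p.2 | dS => - p.2 end%R.

Lemma crd_mv d p : crd d (mv d p) = (crd d p + 1)%R.
Proof. by case: d p => [] [a b] /=; lia. Qed.

Lemma extremal (A : assembly) d : A != [::] -> exists2 u, u \in A &
  forall v, v \in A -> (crd d v.1 <= crd d u.1)%R.
Proof.
elim: A => // a [|b A] IH _.
  by exists a => [|v]; rewrite ?mem_head // inE => /eqP ->.
have [//|u uA H] := IH.
case: (leP (crd d a.1) (crd d u.1)) => h.
  exists u => [|v]; first by rewrite inE uA orbT.
  by rewrite inE => /orP[/eqP->//|/H].
exists a => [|v]; first by rewrite mem_head.
by rewrite inE => /orP[/eqP->//|/H /le_trans]; apply; apply: ltW.
Qed.

(** Among the tiles extremal in direction [d], one extremal in direction [e] is taken; a move along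
    [e] keeps the [d]-coordinate, so the neighbouring cell in direction [e] is empty too. *)
Lemma corner (A : assembly) d e : A != [::] -> (forall p, crd d (mv e p) = crd d p) ->
  exists u, [/\ u \in A, mv d u.1 \notin dom A, mv e u.1 \notin dom A &
    forall v, v \in A -> (crd d v.1 <= crd d u.1)%R].
Proof.
move=> /(extremal d)[u0 u0A H0] P.
have [|u + H] := @extremal (filter (fun v : ptile => crd d v.1 == crd d u0.1) A) e.
  apply/eqP=> e0; have : u0 \in [::] by rewrite -e0 mem_filter eqxx.
  by [].
rewrite mem_filter => /andP[/eqP eu uA]; exists u; split=> //.
- apply/mapP=> -[v vA ev]; have := H0 v vA; rewrite -ev crd_mv eu; lia.
- apply/mapP=> -[v vA ev]; have := H v; rewrite mem_filter vA -ev P eu eqxx /=.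
  move=> /(_ isT); rewrite crd_mv; lia.
- by move=> v /H0; rewrite eu.
Qed.

(** * The tile set *)

(* Glues in the order north, east, south, west; glue 0 does not bind.  The glues 10
   and 11 are the feet. *)
Definition tSW : tiletype := (1, 2, 0, 10).
Definition tW  : tiletype := (1, 3, 1, 0).
Definition tNW : tiletype := (0, 3, 1, 0).
Definition tS  : tiletype := (0, 2, 0, 2).
Definition tSE : tiletype := (4, 0, 0, 2).
Definition tC  : tiletype := (0, 3, 0, 3).
Definition tF  : tiletype := (4, 0, 4, 0).
Definition tNE : tiletype := (11, 0, 4, 5).
Definition tH  : tiletype := (6, 5, 0, 5).
Definition tI  : tiletype := (6, 0, 6, 0).
Definition tXL : tiletype := (7, 10, 0, 0).
Definition tK  : tiletype := (7, 0, 7, 0).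
Definition tQ  : tiletype := (9, 8, 7, 0).
Definition tJ  : tiletype := (0, 8, 0, 8).
Definition tXR : tiletype := (0, 0, 11, 8).
Definition tG  : tiletype := (9, 0, 9, 0).

(** Glue 3 holds the rows with strength 4, glue 4 the column of [tF] with strength 5, glues 10 and
    11 are the feet, and all other binding glues have strength 7. The default value makes further
    glues inert. *)
Definition gstr (g : glue) : nat := nth 0 [:: 0; 7; 7; 4; 5; 7; 7; 7; 7; 7; 3; 3] g.

Definition combs := [:: tSW; tW; tNW; tS; tSE; tC; tF; tNE; tH; tI].
Definition bars := [:: tXL; tK; tQ; tJ; tXR; tG].
Definition tiles := combs ++ bars.

(** * Facts about the tile set decided by computation *)

Definition all_dir (P : dir -> bool) := [&& P dE, P dW, P dN & P dS].

Lemma all_dirP P : all_dir P -> forall d, P d.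
Proof. by case/and4P=> ? ? ? ? []. Qed.

Definition glued d (t u : tiletype) := (gl d t == gl (opp d) u) && (0 < gstr (gl d t)).

Definition all2_tiles (s : seq tiletype) (P : dir -> tiletype -> tiletype -> bool) :=
  all (fun t => all (fun u => all_dir (fun d => P d t u)) s) s.

Lemma all2_tilesP s P : all2_tiles s P ->
  forall d t u, t \in s -> u \in s -> P d t u.
Proof. by move=> /allP H d t u /H /allP K /K /all_dirP; apply. Qed.

Notation bond := (bstr gstr).

Lemma bond_glued u v : 0 < bond u v ->
  exists d, [/\ v.1 = mv d u.1, glued d u.2 v.2 & bond u v = gstr (gl d u.2)].
Proof.
move=> /bstr_dir[d [e g p b]]; exists d; split=> //.
by rewrite /glued g eqxx -g.
Qed.

Lemma glued_bond d u v : v.1 = mv d u.1 -> glued d u.2 v.2 -> bond u v = gstr (gl d u.2).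
Proof. by move=> e /andP[g _]; rewrite (bstr_mv _ e) g. Qed.

Lemma bond_mv d u v : v.1 = mv d u.1 -> 0 < bond u v -> glued d u.2 v.2.
Proof.
by move=> e; rewrite (bstr_mv _ e) /glued; case: eqP.
Qed.

Definition foot d (t u : tiletype) : bool :=
  match d with
  | dE => (t == tXL) && (u == tSW)
  | dW => (t == tSW) && (u == tXL)
  | dN => (t == tNE) && (u == tXR)
  | dS => (t == tXR) && (u == tNE)
  end.

Definition isbar (u : ptile) := u.2 \in bars.

(** Checked on all pairs of types: feet are the only bonds between a bar tile and a comb tile, and
    the only ones weaker than 4. *)
Lemma glue_cases d t u : t \in tiles -> u \in tiles -> glued d t u ->
  if foot d t u then gstr (gl d t) = 3
  else 4 <= gstr (gl d t) /\ (t \in bars) = (u \in bars).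
Proof.
move=> tT uT g; move: (@all2_tilesP tiles (fun d t u => glued d t u ==>
  if foot d t u then gstr (gl d t) == 3
  else (4 <= gstr (gl d t)) && ((t \in bars) == (u \in bars))) isT d t u tT uT).
by rewrite g; case: ifP => _ /=; [move/eqP|case/andP=> -> /eqP].
Qed.

Lemma bond_cases u v : u.2 \in tiles -> v.2 \in tiles -> 0 < bond u v ->
  4 <= bond u v /\ isbar u = isbar v \/
  exists d, [/\ v.1 = mv d u.1, foot d u.2 v.2 & bond u v = 3].
Proof.
move=> uT vT /bond_glued[d [e g ->]]; have := glue_cases uT vT g.
by case: ifP => [f ->|_ [h b]]; [right; exists d|left].
Qed.

Definition lookup (l : seq (tiletype * dir)) t d :=
  has (fun p => (p.1 == t) && (p.2 == d)) l.

(* [l] gives the last directions of all non-backtracking walks that start at a tile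
   of type [r]; no such walk may return to the type [r]. *)
Definition walk_table (s : seq tiletype) (r : tiletype) (l : seq (tiletype * dir)) :=
  [&& all (fun t => all_dir (fun d => glued d r t ==> lookup l t d)) s,
      all_dir (fun d => all2_tiles s (fun d' t u => lookup l t d ==>
         (d' == opp d) || (glued d' t u ==> lookup l u d')))
    & r \notin map fst l].

Definition perp d e :=
  match d, e with (dE | dW), (dN | dS) | (dN | dS), (dE | dW) => true | _, _ => false end.

Lemma crd_perp d e p : perp d e -> crd d (mv e p) = crd d p.
Proof. by case: d e => [] []. Qed.

(* Walks reach the types in [ks] only through types in [ks] and perpendicularly to [e]. *)
Definition walk_keeps (s : seq tiletype) (r : tiletype) (l : seq (tiletype * dir))
    e (ks : seq tiletype) :=
  all (fun t => all_dir (fun d => glued d r t ==> (t \in ks) ==> perp e d)) s &&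
  all_dir (fun d => all2_tiles s (fun d' t u => lookup l t d ==>
     ((d' == opp d) || (glued d' t u ==> (u \in ks) ==> perp e d' && (t \in ks))))).

Section Tables.
Variables (s : seq tiletype) (A : assembly).
Hypotheses (wA : wf A) (cA : connected gstr A) (sA : forall v, v \in A -> v.2 \in s).

Lemma walk_tableP r l u : walk_table s r.2 l -> r \in A -> u \in A ->
  u = r \/ exists d, lookup l u.2 d.
Proof.
case/and3P=> /allP h0 /all_dirP h1 h2 rA uA.
apply: (connected_inv (R := fun d u => lookup l u.2 d) wA cA rA) uA => [d v vA e b|].
  have /all_dirP/(_ d) := h0 _ (sA vA).
  by rewrite (bond_mv e b).
move=> d v d' w vA lv dd wwA e b.
have := all2_tilesP (h1 d) d' (sA vA) (sA wwA).
rewrite lv (bond_mv e b) /=; case: eqP => // /dd [].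
Qed.

(** The type of [r] is absent from the table, so no walk from [r] ends at another tile of that
    type. *)
Lemma walk_uniq r l u : walk_table s r.2 l -> r \in A -> u \in A -> u.2 = r.2 -> u = r.
Proof.
move=> t rA uA e; have [//|[d]] := walk_tableP t rA uA.
case/and3P: t => _ _ /mapP h /hasP[p pl /andP[/eqP e1 _]].
by case: h; exists p; rewrite ?e1.
Qed.

Lemma walk_keepsP r l e ks u : walk_table s r.2 l -> walk_keeps s r.2 l e ks ->
  r \in A -> u \in A -> u.2 \in ks -> crd e u.1 = crd e r.1.
Proof.
case/and3P=> /allP h0 /all_dirP h1 _ /andP[/allP k0 /all_dirP k1] rA uA.
pose R d (u : ptile) := lookup l u.2 d /\ (u.2 \in ks -> crd e u.1 = crd e r.1).
suff [->//|[d [_ //]]] : u = r \/ exists d, R d u.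
apply: (connected_inv (R := R) wA cA rA) uA => [d v vA ev b|].
  have /all_dirP/(_ d) := h0 _ (sA vA); have /all_dirP/(_ d) := k0 _ (sA vA).
  rewrite (bond_mv ev b) /= => K L; split=> // vk; rewrite vk /= in K.
  by rewrite ev crd_perp.
move=> d v d' w vA [lv kv] dd wwA ew b.
have := all2_tilesP (h1 d) d' (sA vA) (sA wwA).
have := all2_tilesP (k1 d) d' (sA vA) (sA wwA).
rewrite lv (bond_mv ew b) /=; case: eqP => [/dd []|_ /= K L]; split=> // wk.
by case/andP: (implyP K wk) => p tk; rewrite ew crd_perp // kv.
Qed.

End Tables.

(** Rows of [tC] bond only east-west and columns of [tF] only north-south, so the bonds follow a
    tree pattern: on walks from a given corner or foot, each type is entered in a single
    direction. *)
Definition tabSW := [:: (tW, dN); (tNW, dN); (tC, dE); (tS, dE); (tSE, dE); (tF, dN);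
  (tNE, dN); (tH, dW); (tI, dN)].
Definition tabNW := [:: (tW, dS); (tSW, dS); (tC, dE); (tS, dE); (tSE, dE); (tF, dN);
  (tNE, dN); (tH, dW); (tI, dN)].
Definition tabSE := [:: (tF, dN); (tNE, dN); (tH, dW); (tI, dN); (tS, dW); (tSW, dW);
  (tW, dN); (tNW, dN); (tC, dE)].
Definition tabNE := [:: (tF, dS); (tSE, dS); (tS, dW); (tSW, dW); (tW, dN); (tNW, dN);
  (tC, dE); (tH, dW); (tI, dN)].
Definition tabXL := [:: (tK, dN); (tQ, dN); (tJ, dE); (tXR, dE); (tG, dN)].
Definition tabXR := [:: (tJ, dW); (tQ, dW); (tK, dS); (tXL, dS); (tG, dN)].

Lemma tabSW_ok : walk_table combs tSW tabSW. Proof. by []. Qed.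
Lemma tabNW_ok : walk_table combs tNW tabNW. Proof. by []. Qed.
Lemma tabSE_ok : walk_table combs tSE tabSE. Proof. by []. Qed.
Lemma tabNE_ok : walk_table combs tNE tabNE. Proof. by []. Qed.
Lemma tabXL_ok : walk_table bars tXL tabXL. Proof. by []. Qed.
Lemma tabXR_ok : walk_table bars tXR tabXR. Proof. by []. Qed.

Section Unique.
Variable A : assembly.
Hypotheses (wA : wf A) (cA : connected gstr A).

Lemma uniq_tile t u v : t \in [:: tSW; tNW; tSE; tNE] ->
  (forall v, v \in A -> v.2 \in combs) ->
  u \in A -> v \in A -> u.2 = t -> v.2 = t -> u = v.
Proof.
move=> ht sA uA vA eu ev.
have [l hl] : exists l, walk_table combs t l.
  move: ht; rewrite !inE => /or4P[] /eqP ->.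
  - by exists tabSW; apply: tabSW_ok.
  - by exists tabNW; apply: tabNW_ok.
  - by exists tabSE; apply: tabSE_ok.
  - by exists tabNE; apply: tabNE_ok.
by apply: (walk_uniq wA cA sA (l := l)) => //; rewrite ?ev ?eu.
Qed.

Lemma uniq_bar t u v : t \in [:: tXL; tXR] -> (forall v, v \in A -> v.2 \in bars) ->
  u \in A -> v \in A -> u.2 = t -> v.2 = t -> u = v.
Proof.
move=> ht sA uA vA eu ev.
have [l hl] : exists l, walk_table bars t l.
  by move: ht; rewrite !inE => /orP[] /eqP ->; [exists tabXL; apply: tabXL_ok|exists tabXR; apply: tabXR_ok].
by apply: (walk_uniq wA cA sA (l := l)) => //; rewrite ?ev ?eu.
Qed.

End Unique.

(** * Producible assemblies *)

Definition part b (A : assembly) := filter (fun u => isbar u == b) A.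

Definition feet (A : assembly) := exists xl sw ne xr,
  [/\ [/\ xl \in A, sw \in A, ne \in A & xr \in A],
      [/\ xl.2 = tXL, sw.2 = tSW, ne.2 = tNE & xr.2 = tXR],
      sw.1 = mv dE xl.1 & xr.1 = mv dN ne.1].

Definition typed (A : assembly) := forall u, u \in A -> u.2 \in tiles.

(** Invariant of producible assemblies. Separate connectedness of the bar part and of the comb part
    makes the walk tables applicable to each; the last field excludes a bar and a comb held together
    by one foot alone. *)
Record good (A : assembly) : Prop := Good {
  good_wf : wf A;
  good_typed : typed A;
  good_conn : connected gstr A;
  good_part : forall b, connected gstr (part b A);
  good_feet : part true A != [::] -> part false A != [::] -> feet A }.
Arguments good_part [A] _ b [x y].

Lemma mem_part b A u : (u \in part b A) = (isbar u == b) && (u \in A).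
Proof. by rewrite mem_filter. Qed.

Lemma part_neq0 b A u : u \in A -> isbar u = b -> part b A != [::].
Proof.
move=> uA e; apply/eqP=> e0; have : u \in [::] by rewrite -e0 mem_part e eqxx.
by [].
Qed.

Lemma part_inh b A : part b A != [::] -> exists2 u, u \in A & isbar u = b.
Proof.
case e : (part b A) => [//|u s] _; have : u \in part b A by rewrite e mem_head.
by rewrite mem_part => /andP[/eqP]; exists u.
Qed.

Lemma wf_part b A : wf A -> wf (part b A).
Proof. by apply: subseq_uniq; apply: map_subseq; apply: filter_subseq. Qed.

Lemma part_nil_eq b A : part b A = [::] -> part (~~ b) A =i A.
Proof.
move=> e u; rewrite mem_part; case uA : (u \in A); last by rewrite andbF.
rewrite andbT; case eb : (isbar u == b).
  by have := mem_part b A u; rewrite e uA eb.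
by case: (isbar u) b eb {e} => [] [].
Qed.

Lemma bond_ge3 u v : u.2 \in tiles -> v.2 \in tiles -> 0 < bond u v -> 3 <= bond u v.
Proof. by move=> uT vT /(bond_cases uT vT)[[/ltnW]|[d [_ _ ->]]]. Qed.

Lemma bond_same u v : u.2 \in tiles -> v.2 \in tiles -> 0 < bond u v ->
  isbar u = isbar v -> 4 <= bond u v.
Proof.
move=> uT vT /(bond_cases uT vT)[[]//|[d [_ + _]]]; rewrite /isbar.
by case: d => /andP[/eqP-> /eqP->].
Qed.

Lemma bond_diff u v : u.2 \in tiles -> v.2 \in tiles -> 0 < bond u v ->
  isbar u -> ~~ isbar v ->
  bond u v = 3 /\ ([/\ v.1 = mv dE u.1, u.2 = tXL & v.2 = tSW] \/
                   [/\ v.1 = mv dS u.1, u.2 = tXR & v.2 = tNE]).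
Proof.
move=> uT vT /(bond_cases uT vT)[[_ ->]|[d [e f b]] iu iv]; first by move=> ->.
split=> //; move: e f iu; rewrite /isbar; case: d => e /andP[/eqP-> /eqP->] // _.
  by left.
by right.
Qed.

Lemma bond_foot u v d : v.1 = mv d u.1 -> foot d u.2 v.2 -> bond u v = 3.
Proof.
move=> e f; have g : glued d u.2 v.2 by case: d f {e} => /andP[/eqP-> /eqP->].
by rewrite (glued_bond e g); case: d f {e g} => /andP[/eqP-> _].
Qed.

(* Every bond has strength at least 3, and 4 + 3 > 6. *)
Lemma strong_alone A B u v u' v' : typed A -> typed B -> cut_str gstr A B <= 6 ->
  u \in A -> v \in B -> u' \in A -> v' \in B ->
  4 <= bond u v -> 0 < bond u' v' -> u' = u /\ v' = v.
Proof.
move=> tA tB c uA vB uA' vB' h h'.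
case: (eqVneq (u', v') (u, v)) => [[-> ->]//|ne].
have := bond_ge3 (tA _ uA') (tB _ vB') h'; rewrite eq_sym in ne.
have := cut_ge2 gstr uA vB uA' vB' ne; lia.
Qed.

Definition anchors := [:: tSW; tNW; tSE; tNE; tXL; tXR].

Lemma uniq_anchor A b u v : wf A -> typed A -> connected gstr (part b A) ->
  u \in A -> v \in A -> isbar u = b -> u.2 \in anchors -> v.2 = u.2 -> v = u.
Proof.
move=> w tA c uA vA ub ua e.
have vb : isbar v = b by rewrite /isbar e.
have uP : u \in part b A by rewrite mem_part ub eqxx.
have vP : v \in part b A by rewrite mem_part vb eqxx.
have tP x : x \in part b A -> x.2 \in (if b then bars else combs).
  rewrite mem_part => /andP[/eqP xb /tA]; rewrite mem_cat -/(isbar x) xb.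
  by case: (b) xb => //; rewrite orbF.
have wP := wf_part b w.
case: b {vb} ub c uP vP tP wP => ub c uP vP tP wP.
  apply: (uniq_bar wP c (t := u.2)) => //.
  have := allP (isT : all (fun t => (t \in bars) ==> (t \in [:: tXL; tXR])) anchors) _ ua.
  by move: ub; rewrite /isbar => ->.
apply: (uniq_tile wP c (t := u.2)) => //.
have := allP (isT : all (fun t => (t \notin bars) ==> (t \in [:: tSW; tNW; tSE; tNE])) anchors) _ ua.
by move: ub; rewrite /isbar => ->.
Qed.

Lemma feet_sub A B : {subset A <= B} -> feet A -> feet B.
Proof.
move=> s [xl [sw [ne [xr [[m1 m2 m3 m4] e1 e2 e3]]]]].
by exists xl, sw, ne, xr; split=> //; split; apply: s.
Qed.

Lemma feet_anchor A b : feet A -> exists u,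
  [/\ u \in A, isbar u = b & u.2 = if b then tXL else tSW].
Proof.
move=> [xl [sw [ne [xr [[m1 m2 m3 m4] [e1 e2 e3 e4] _ _]]]]].
by case: b; [exists xl|exists sw]; rewrite /isbar ?e1 ?e2.
Qed.

Lemma good_feet2 A u v : good A -> u \in A -> v \in A -> isbar u -> isbar v = false ->
  feet A.
Proof. by move=> g uA vA iu iv; apply: (good_feet g); [apply: part_neq0 uA _|apply: part_neq0 vA _]. Qed.

(** If [P] also had comb tiles, its bar would already use both feet, and by uniqueness of anchors
    the cell of [v] would be occupied by a tile of [P]. Symmetrically, a bar tile in [Q] would make
    [Q] occupy the cell of [u]. *)
Lemma combine_foot G P Q u v : good P -> good Q -> union_of G P Q ->
  u \in P -> v \in Q -> isbar u -> isbar v = false -> 0 < bond u v ->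
  (forall w, w \in P -> isbar w) /\ (forall w, w \in Q -> isbar w = false).
Proof.
move=> gP gQ U uP vQ iu iv b.
have [_ h] := bond_diff (good_typed gP uP) (good_typed gQ vQ) b iu (negbT iv).
split=> w wP; case iw : (isbar w) => //.
- have [xl [sw [ne [xr [[m1 m2 m3 m4] [e1 e2 e3 e4] e5 e6]]]]] := good_feet2 gP uP wP iu iw.
  case: h => -[ev eu1 ev1].
  + have ex : u = xl.
      by apply: (uniq_anchor (good_wf gP) (good_typed gP) (good_part gP true)) => //;
        rewrite /isbar ?e1 ?eu1.
    by case: (union_disj U m2 vQ); rewrite ev e5 ex.
  + have ex : u = xr.
      by apply: (uniq_anchor (good_wf gP) (good_typed gP) (good_part gP true)) => //;
        rewrite /isbar ?e4 ?eu1.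
    by case: (union_disj U m3 vQ); rewrite ev ex e6 (mv_oppK dN).
- have [xl [sw [ne [xr [[m1 m2 m3 m4] [e1 e2 e3 e4] e5 e6]]]]] := good_feet2 gQ wP vQ iw iv.
  case: h => -[ev eu1 ev1].
  + have ex : v = sw.
      by apply: (uniq_anchor (good_wf gQ) (good_typed gQ) (good_part gQ false)) => //;
        rewrite /isbar ?e2 ?ev1.
    case: (union_disj U uP m1); rewrite -(mv_oppK dE u.1) -ev ex e5.
    by rewrite (mv_oppK dE).
  + have ex : v = ne.
      by apply: (uniq_anchor (good_wf gQ) (good_typed gQ) (good_part gQ false)) => //;
        rewrite /isbar ?e3 ?ev1.
    case: (union_disj U uP m4); rewrite e6 -ex ev.
    by rewrite (mv_oppK dS).
Qed.

(** A single foot has strength 3, below the required 4, so both feet of the bar [P] bond to the comb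
    [Q]. *)
Lemma combine_good_foot G P Q u v : good P -> good Q -> union_of G P Q ->
  4 <= cut_str gstr P Q ->
  u \in P -> v \in Q -> isbar u -> isbar v = false -> 0 < bond u v -> good G.
Proof.
move=> gP gQ U c uP vQ iu iv b.
have [bP bQ] := combine_foot gP gQ U uP vQ iu iv b.
have tP := good_typed gP; have tQ := good_typed gQ.
(* If no bond of the second kind crosses, all crossing bonds are of the first kind, and uniqueness
   of the anchor [tx] leaves only the pair [u], [v]. The claim is used once for each foot. *)
have key (tx ty : tiletype) dd (tx' ty' : tiletype) dd' : tx \in anchors ->
   (forall u v, u \in P -> v \in Q -> 0 < bond u v ->
      [/\ v.1 = mv dd u.1, u.2 = tx & v.2 = ty] \/
      [/\ v.1 = mv dd' u.1, u.2 = tx' & v.2 = ty']) ->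
   exists u v, [/\ u \in P, v \in Q, v.1 = mv dd' u.1, u.2 = tx' & v.2 = ty'].
  move=> tA H.
  case: (boolP (has (fun u => has (fun v =>
      [&& v.1 == mv dd' u.1, u.2 == tx' & v.2 == ty']) Q) P)).
    case/hasP=> u1 u1P /hasP[v1 v1Q /and3P[/eqP ? /eqP ? /eqP ?]].
    by exists u1, v1.
  move=> /hasPn no; exfalso.
  have only u1 v1 : u1 \in P -> v1 \in Q -> 0 < bond u1 v1 ->
      [/\ v1.1 = mv dd u1.1 , u1.2 = tx & v1.2 = ty].
    move=> u1P v1Q b1; case: (H _ _ u1P v1Q b1) => // -[h1 h2 h3].
    by have /hasPn/(_ _ v1Q) := no _ u1P; rewrite h1 h2 h3 !eqxx.
  have [e1 e2 e3] := only _ _ uP vQ b.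
  have := cut_ub (str := gstr) (E := [:: (u, v)]) (wf_uniq (good_wf gP)) (wf_uniq (good_wf gQ)).
  rewrite big_seq1 /= (proj1 (bond_diff (tP _ uP) (tQ _ vQ) b iu (negbT iv))) => K.
  suff : cut_str gstr P Q <= 3 by lia.
  apply: K => u1 v1 u1P v1Q b1; have [f1 f2 f3] := only _ _ u1P v1Q b1.
  have eu : u1 = u.
    apply: (uniq_anchor (good_wf gP) tP (good_part gP true)) => //.
      by rewrite e2.
    by rewrite f2 e2.
  have ev : v1 = v by apply: (wf_inj (good_wf gQ)) => //; rewrite f1 e1 eu.
  by rewrite eu ev mem_head.
have H u1 v1 : u1 \in P -> v1 \in Q -> 0 < bond u1 v1 ->
    [/\ v1.1 = mv dE u1.1, u1.2 = tXL & v1.2 = tSW] \/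
    [/\ v1.1 = mv dS u1.1, u1.2 = tXR & v1.2 = tNE].
  move=> u1P v1Q b1.
  by have [] := bond_diff (tP _ u1P) (tQ _ v1Q) b1 (bP _ u1P) (negbT (bQ _ v1Q)).
have [xr [ne [m4 m3 e6 e4 e3]]] := key tXL tSW dE tXR tNE dS isT H.
have [xl [sw [m1 m2 e5 e1 e2]]] := key tXR tNE dS tXL tSW dE isT
  (fun u1 v1 u1P v1Q b1 => proj1 (or_comm _ _) (H u1 v1 u1P v1Q b1)).
have mL := union_memL U; have mR := union_memR U.
split.
- by case: U.
- by move=> w; rewrite (union_mem U) mem_cat => /orP[/tP|/tQ].
- exact: (connected_union U (good_conn gP) (good_conn gQ) uP vQ b).
- case.
    apply: connected_eq_mem (good_conn gP) => w; rewrite mem_part (union_mem U) mem_cat.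
    case wP : (w \in P); first by rewrite bP.
    by case wQ : (w \in Q); rewrite ?andbF // bQ.
  apply: connected_eq_mem (good_conn gQ) => w; rewrite mem_part (union_mem U) mem_cat.
  case wQ : (w \in Q); first by rewrite bQ // orbT.
  by case wP : (w \in P); rewrite ?andbF // bP.
- move=> _ _; exists xl, sw, ne, xr; split=> //; first by split; auto.
  by rewrite e6 (mv_oppK dS).
Qed.

(** The class of [u] stays connected through the new bond. If the other class occurred on both
    sides, [P] and [Q] would both have feet, hence an anchor of the class of [u] each, and the
    connected part would contain that anchor twice. So the other class comes from one side, together
    with its feet. *)
Lemma combine_good_same G P Q u v : good P -> good Q -> union_of G P Q ->
  u \in P -> v \in Q -> isbar u = isbar v -> 0 < bond u v -> good G.
Proof.
move=> gP gQ U uP vQ iuv b.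
have tP := good_typed gP; have tQ := good_typed gQ.
have mL := union_memL U; have mR := union_memR U.
have wG : wf G by case: U.
have tG : typed G by move=> w; rewrite (union_mem U) mem_cat => /orP[/tP|/tQ].
have c1 : connected gstr (part (isbar u) G).
  apply: (connected_union (union_filter _ U) (good_part gP (isbar u))
           (good_part gQ (isbar u)) (u := u) (v := v)) => //.
    by rewrite mem_part eqxx.
  by rewrite mem_part iuv eqxx.
have fP w : w \in P -> isbar w = ~~ isbar u -> feet P.
  move=> wP; case iu : (isbar u) => iw; first exact: (good_feet2 gP uP wP).
  exact: (good_feet2 gP wP uP).
have fQ w : w \in Q -> isbar w = ~~ isbar u -> feet Q.
  rewrite iuv => wQ; case iv : (isbar v) => iw; first exact: (good_feet2 gQ vQ wQ).
  exact: (good_feet2 gQ wQ vQ).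
have c2 : connected gstr (part (~~ isbar u) G).
  have sub w : (w \in part (~~ isbar u) G) =
      (w \in part (~~ isbar u) P ++ part (~~ isbar u) Q).
    by rewrite mem_cat !mem_part (union_mem U) mem_cat andb_orr.
  case eP : (part (~~ isbar u) P) => [|x s].
    apply: connected_eq_mem (good_part gQ (~~ isbar u)) => w.
    by rewrite sub eP.
  case eQ : (part (~~ isbar u) Q) => [|y s'].
    apply: connected_eq_mem (good_part gP (~~ isbar u)) => w.
    by rewrite sub eQ cats0.
  have [x' xP ix] : exists2 x, x \in P & isbar x = ~~ isbar u by apply: part_inh; rewrite eP.
  have [y' yQ iy] : exists2 x, x \in Q & isbar x = ~~ isbar u by apply: part_inh; rewrite eQ.
  have [p [pP ip ep]] := feet_anchor (isbar u) (fP _ xP ix).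
  have [q [qQ iq eq]] := feet_anchor (isbar u) (fQ _ yQ iy).
  have epq : q = p.
    apply: (uniq_anchor wG tG c1) => //; [exact: mL|exact: mR| |by rewrite ep eq].
    by rewrite ep; case: (isbar u).
  by case: (union_disj U pP qQ); rewrite epq.
split=> //.
- exact: (connected_union U (good_conn gP) (good_conn gQ) uP vQ b).
- by move=> b'; case: (eqVneq b' (isbar u)) => [->//|]; case: b' (isbar u) c1 c2 => [] [].
move=> n1 n2; have [w wG' iw] : exists2 w, w \in G & isbar w = ~~ isbar u.
  by case: (isbar u) ; apply: part_inh.
move: wG'; rewrite (union_mem U) mem_cat => /orP[wP|wQ].
  exact: feet_sub mL (fP _ wP iw).
exact: feet_sub mR (fQ _ wQ iw).
Qed.

Lemma combine_good G P Q : good P -> good Q -> union_of G P Q ->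
  4 <= cut_str gstr P Q -> good G.
Proof.
move=> gP gQ U c; have [u [v [uP vQ b]]] := cut_pos (leq_trans (isT : 0 < 4) c).
case iu : (isbar u); case iv : (isbar v).
- by apply: (combine_good_same gP gQ U uP vQ) => //; rewrite iu iv.
- exact: (combine_good_foot gP gQ U c uP vQ).
- apply: (combine_good_foot gQ gP (union_sym U) _ vQ uP) => //.
    by rewrite cut_sym.
  by rewrite bstr_sym.
- by apply: (combine_good_same gP gQ U uP vQ) => //; rewrite iu iv.
Qed.

(** If [A] has both classes, a bond of strength at least 4 inside some class crosses the cut, and by
    [strong_alone] it is the only crossing bond. Hence [B] has a single class, both parts of [A]
    stay connected, and no foot is lost. *)
Lemma break_good G A B : good G -> union_of G A B -> B != [::] ->
  connected gstr A -> cut_str gstr A B <= 6 -> good A.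
Proof.
move=> gG U B0 cA cut6.
have mL := union_memL U; have mR := union_memR U.
have wA := union_wfL U.
have tA : typed A by move=> u /mL; exact: (good_typed gG).
have tB : typed B by move=> u /mR; exact: (good_typed gG).
have alone b u v : u \in part b A -> v \in part b B -> 0 < bond u v ->
    forall u' v', u' \in A -> v' \in B -> 0 < bond u' v' -> u' = u /\ v' = v.
  rewrite !mem_part => /andP[/eqP iu uA] /andP[/eqP iv vB] h u' v' uA' vB' h'.
  apply: (strong_alone tA tB cut6) => //.
  by apply: bond_same; auto; rewrite iu iv.
have crossb b : part b A != [::] -> part b B != [::] ->
    exists u v, [/\ u \in part b A, v \in part b B & 0 < bond u v].
  exact: (connected_cross (good_part gG b) (union_filter _ U)).
case e1 : (part true A) => [|x s].
  split=> //; last by rewrite e1.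
  case; first by rewrite e1.
  by apply: connected_eq_mem cA => w; rewrite (part_nil_eq e1).
case e2 : (part false A) => [|y s'].
  split=> //; last by rewrite e2.
  case; last by rewrite e2.
  by apply: connected_eq_mem cA => w; rewrite (part_nil_eq e2).
have n0 b : part b A != [::] by case: b; rewrite ?e1 ?e2.
have {e1 e2} _ := (e1, e2).
have [w wB] : exists w, w \in B by case: B B0 {U cut6 mR tB alone crossb} => // w ?; exists w; rewrite mem_head.
pose b := isbar w.
have nB : part b B != [::] by apply: part_neq0 wB _.
have [u [v [uA vB h]]] := crossb b (n0 b) nB.
have al := alone _ _ _ uA vB h.
have nB' : part (~~ b) B = [::].
  apply/eqP; apply: contraT => nB'.
  have [u' [v' [uA' vB' h']]] := crossb _ (n0 _) nB'.
  move: uA' vB'; rewrite !mem_part => /andP[/eqP iu uA'] /andP[_ vB'].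
  have [eu _] := al _ _ uA' vB' h'.
  by move: uA; rewrite mem_part -eu iu; case: (b).
have cp b' : connected gstr (part b' A).
  case: (eqVneq b' b) => [->|nb].
    apply: (connected_leaf (good_part gG b) (union_filter _ U) (u0 := u)).
    move=> u' v'; rewrite !mem_filter => /andP[_ uA'] /andP[_ vB'] h'.
    by have [] := al _ _ uA' vB' h'.
  have -> : b' = ~~ b by case: b' (b) nb => [] [].
  apply: connected_eq_mem (good_part gG (~~ b)) => z.
  rewrite !mem_part (union_mem U) mem_cat andb_orr orbC.
  by have := mem_part (~~ b) B z; rewrite nB' => <-.
split=> //.
have [||xl [sw [ne [xr [[m1 m2 m3 m4] [t1 t2 t3 t4] e5 e6]]]]] := good_feet gG.
- by have [z /mL zG iz] := part_inh (n0 true); apply: part_neq0 zG iz.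
- by have [z /mL zG iz] := part_inh (n0 false); apply: part_neq0 zG iz.
have b1 : 0 < bond xl sw by rewrite (bond_foot e5) //= t1 t2.
have b2 : 0 < bond ne xr by rewrite (bond_foot e6) //= t3 t4.
(* A bond between the classes cannot cross the cut, whose only bond joins tiles of equal class, nor
   lie inside [B]. *)
have both x' y' : x' \in G -> y' \in G -> 0 < bond x' y' -> isbar x' != isbar y' ->
    x' \in A /\ y' \in A.
  rewrite !(union_mem U) !mem_cat.
  have iuv : isbar u = isbar v.
    by move: uA vB; rewrite !mem_part => /andP[/eqP-> _] /andP[/eqP->].
  move=> /orP[xA|xB] /orP[yA|yB] hb ne'; split=> //.
  - by have [ex ey] := al _ _ xA yB hb; rewrite ex ey iuv eqxx in ne'.
  - by rewrite bstr_sym in hb; have [ex ey] := al _ _ yA xB hb; rewrite ex ey iuv eqxx in ne'.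
  - have := nB'; case: (eqVneq (isbar x') b) => [ix|nx].
      have : y' \in part (~~ b) B by rewrite mem_part yB -ix; case: (isbar x') (isbar y') ne' => [] [].
      by move=> + e; rewrite e.
    have : x' \in part (~~ b) B by rewrite mem_part xB; case: (isbar x') (b) nx => [] [].
    by move=> + e; rewrite e.
  - have := nB'; case: (eqVneq (isbar x') b) => [ix|nx].
      have : y' \in part (~~ b) B by rewrite mem_part yB -ix; case: (isbar x') (isbar y') ne' => [] [].
      by move=> + e; rewrite e.
    have : x' \in part (~~ b) B by rewrite mem_part xB; case: (isbar x') (b) nx => [] [].
    by move=> + e; rewrite e.
have [|mxl msw] := both _ _ m1 m2 b1; first by rewrite /isbar t1 t2.
have [|mne mxr] := both _ _ m3 m4 b2; first by rewrite /isbar t3 t4.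
by move=> _ _; exists xl, sw, ne, xr.
Qed.

(** For [k > 0] the value is 4 below [k - 1], 5 at [k - 1], 6 from [k] to [2k], and 7 beyond. The
    first two jumps defeat the bonds of strength 4 and 5; the last one defeats the two feet, 3 +
    3. *)
Definition temp k m := 4 + (k.-1 <= m) + (k <= m) + (k.*2 < m).

Lemma temp_mono k : nondecreasing_fun (temp k).
Proof. rewrite /nondecreasing_fun /temp; lia. Qed.

Lemma temp_bounds k m : 4 <= temp k m <= 7.
Proof. by rewrite /temp; case: (k.-1 <= m); case: (k <= m); case: (k.*2 < m). Qed.

Lemma producible_neq0 str T t A : producible str T t A -> A != [::].
Proof.
elim=> [//|a b g _ a0 _ _ [p _] _|//].
by apply: contraNneq a0 => e; have := perm_size p; rewrite e size_cat; case: (a).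
Qed.

(** As [temp] ranges from 4 to 7, combinations have cuts of at least 4 and breaks have cuts of at
    most 6. *)
Lemma producible_good k A : producible gstr tiles (temp k) A -> good A.
Proof.
elim=> [t p tT|P Q G _ gP _ gQ U c|G A' B _ gG U A0 B0 cA cB c].
- split=> //.
  + by move=> u; rewrite inE => /eqP->.
  + by move=> x y; rewrite !inE => /eqP-> /eqP->; exists [::].
  + move=> b; rewrite /part /=; case: ifP => _ // x y.
    by rewrite !inE => /eqP-> /eqP->; exists [::].
  + by rewrite /part /=; case: (isbar _).
- apply: (combine_good gP gQ U); apply: leq_trans c.
  by case/andP: (temp_bounds k (minn (size P) (size Q))).
- apply: (break_good gG U B0 cA).
  by case/andP: (temp_bounds k (minn (size A') (size B))); lia.
Qed.

(** * Terminal assemblies are squares *)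

(* [pos] and [tiletype] occur both folded and unfolded in the implicit arguments
   of the projections, which hides equal atoms from [lia]. *)
Ltac plia :=
  repeat match goal with
  | H : forall _, _ |- _ => clear H
  | H : is_true (_ \in _) |- _ => clear H
  | H : is_true (wf _) |- _ => clear H
  | H : is_true (_ != [::]) |- _ => clear H
  | H : connected _ _ |- _ => clear H
  | H := _ |- _ => clearbody H
  end; unfold pos, tiletype, glue in *; lia.

Definition saturated (A : assembly) :=
  forall (u : ptile) d, u \in A -> 4 <= gstr (gl d u.2) -> mv d u.1 \in dom A.

Lemma domP (A : assembly) q : reflect (exists t, (q, t) \in A) (q \in dom A).
Proof.
apply: (iffP mapP) => [[[p t] pA ->]|[t tA]]; first by exists t.
by exists (q, t).
Qed.

Lemma dom_mem (A : assembly) (u : ptile) : u \in A -> u.1 \in dom A.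
Proof. exact: map_f. Qed.

Lemma temp1 k : 2 < k -> temp k 1 = 4.
Proof. rewrite /temp; plia. Qed.

Lemma tiles_partner d t : t \in tiles -> 4 <= gstr (gl d t) ->
  exists2 w, w \in tiles & gl (opp d) w = gl d t.
Proof.
move=> tT; have /allP/(_ t tT)/all_dirP/(_ d)/implyP h : all (fun t => all_dir (fun d =>
  (4 <= gstr (gl d t)) ==> has (fun w => gl (opp d) w == gl d t) tiles)) tiles by [].
by move/h=> /hasP[w wT /eqP e]; exists w.
Qed.

(** Every glue of strength at least 4 has a partner tile, and [2 < k] makes the temperature for
    attaching a single tile equal to 4. *)
Lemma terminal_saturated k A : 2 < k -> terminal gstr tiles (temp k) A -> saturated A.
Proof.
move=> k2 [pA [nc _]] u d uA s; apply: contraT => nA.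
have gA := producible_good pA.
have [w wT e] := tiles_partner (good_typed gA uA) s.
case: (nc [:: (mv d u.1, w)]); first exact: prod_tile.
split.
  rewrite /wf map_cat cats1 rcons_uniq nA; exact: good_wf gA.
have s0 : 0 < size A by case: (A) uA.
rewrite /= (minn_idPr _) // temp1 //.
apply: leq_trans (cut_ge1 _ uA (mem_head _ _)).
by rewrite (@bstr_mv _ d) //= e eqxx.
Qed.

(** In a saturated assembly no glue of strength at least 4 faces an empty cell, so this leaves [t]
    as the only type that can sit in the corner. *)
Definition corner_table (s : seq tiletype) d e t :=
  all (fun u => [|| 4 <= gstr (gl d u), 4 <= gstr (gl e u) | u == t]) s.

Lemma corner_tile s A d e t : saturated A -> (forall v, v \in A -> v.2 \in s) -> A != [::] ->
  perp d e -> corner_table s d e t ->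
  exists u : ptile, [/\ u \in A, u.2 = t & forall v, v \in A -> (crd d v.1 <= crd d u.1)%R].
Proof.
move=> cA sA A0 p /allP T.
have [u [uA nd ne H]] := corner A0 (fun q => crd_perp q p).
exists u; split=> //; have /or3P[h|h|/eqP//] := T _ (sA _ uA).
- by rewrite cA in nd.
- by rewrite cA in ne.
Qed.

(** The four computations put the spine in the column of [tSW], the bottom row in the row of [tSW],
    the tiles [tF] in the column of [tSE], and the hair [tH] in the row of [tNE]. *)
Lemma keepSW_x : walk_keeps combs tSW tabSW dE [:: tW; tNW].
Proof. by vm_compute. Qed.

Lemma keepSW_y : walk_keeps combs tSW tabSW dN [:: tS; tSE].
Proof. by vm_compute. Qed.

Lemma keepSE_x : walk_keeps combs tSE tabSE dE [:: tF; tNE].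
Proof. by vm_compute. Qed.

Lemma keepNE_y : walk_keeps combs tNE tabNE dN [:: tH].
Proof. by vm_compute. Qed.

(** A north-west corner can only be [tNW], as the corner [tQ] of a bar has the strong north glue of
    its hair. The spine puts [tNW] in the column of [tSW], whereas a bar has its foot one column
    further west. *)
Lemma saturated_comb A : good A -> saturated A -> A != [::] -> part true A = [::].
Proof.
move=> gA cA A0; have wA := good_wf gA; have tA := good_typed gA.
have [nw [nwA nwt H]] := corner_tile (d := dW) (e := dN) (t := tNW) cA tA A0 isT isT.
apply/eqP; apply: contraT => nb.
have [|xl [sw [ne [xr [[m1 m2 m3 m4] [t1 t2 t3 t4] e5 e6]]]]] := good_feet gA nb.
  by apply: part_neq0 nwA _; rewrite /isbar nwt.
have m2' : sw \in part false A by rewrite mem_part m2 /isbar t2.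
have nw' : nw \in part false A by rewrite mem_part nwA /isbar nwt.
have sP v : v \in part false A -> v.2 \in combs.
  by rewrite mem_part /isbar => /andP[/eqP h /tA]; rewrite mem_cat h orbF.
have e : crd dE nw.1 = crd dE sw.1.
  have T : walk_table combs sw.2 tabSW by rewrite t2; apply: tabSW_ok.
  have K : walk_keeps combs sw.2 tabSW dE [:: tW; tNW] by rewrite t2; apply: keepSW_x.
  apply: (walk_keepsP (wf_part false wA) (good_part gA false) sP T K) => //.
  by rewrite nwt.
have := H _ m1; move: e; rewrite e5 crd_mv /= => ->; plia.
Qed.

(** * Saturated combs are full rectangles *)

Section Rectangle.
Variable A : assembly.
Implicit Types u v : ptile.
Hypotheses (wA : wf A) (conA : connected gstr A) (A0 : A != [::]).
Hypotheses (cA : saturated A) (sA : forall v, v \in A -> v.2 \in combs).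

Lemma rect_corners : exists (p : pos) (n m : nat),
  [/\ [/\ (p, tSW) \in A, ((p.1, p.2 + m%:Z)%R, tNW) \in A,
       ((p.1 + n%:Z, p.2)%R, tSE) \in A & ((p.1 + n%:Z, p.2 + m%:Z)%R, tNE) \in A] ,
   0 < n, 0 < m &
   forall v, v \in A -> (p.1 <= v.1.1 <= p.1 + n%:Z)%R && (p.2 <= v.1.2 <= p.2 + m%:Z)%R].
Proof.
have un t u v : t \in [:: tSW; tNW; tSE; tNE] -> u \in A -> v \in A ->
   u.2 = t -> v.2 = t -> v = u.
  by move=> ht *; apply: (uniq_tile wA conA ht sA).
(* Each corner is found for both orders of its two directions; uniqueness identifies the two tiles,
   so the corner is extremal in both. *)
have [sw [m1 t1 h1]] := corner_tile (d := dW) (e := dS) (t := tSW) cA sA A0 isT isT.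
have [sw' [m1' t1' h1']] := corner_tile (d := dS) (e := dW) (t := tSW) cA sA A0 isT isT.
have [nw [m2 t2 h2]] := corner_tile (d := dW) (e := dN) (t := tNW) cA sA A0 isT isT.
have [nw' [m2' t2' h2']] := corner_tile (d := dN) (e := dW) (t := tNW) cA sA A0 isT isT.
have [se [m3 t3 h3]] := corner_tile (d := dE) (e := dS) (t := tSE) cA sA A0 isT isT.
have [se' [m3' t3' h3']] := corner_tile (d := dS) (e := dE) (t := tSE) cA sA A0 isT isT.
have [ne [m4 t4 h4]] := corner_tile (d := dE) (e := dN) (t := tNE) cA sA A0 isT isT.
have [ne' [m4' t4' h4']] := corner_tile (d := dN) (e := dE) (t := tNE) cA sA A0 isT isT.
rewrite (un tSW sw sw') // in h1'.
rewrite (un tNW nw nw') // in h2'.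
rewrite (un tSE se se') // in h3'.
rewrite (un tNE ne ne') // in h4'.
clear sw' m1' t1' nw' m2' t2' se' m3' t3' ne' m4' t4'.
have box v : v \in A -> (sw.1.1 <= v.1.1 <= ne.1.1)%R && (sw.1.2 <= v.1.2 <= ne.1.2)%R.
  move=> vA; have := h1 _ vA; have := h1' _ vA; have := h4 _ vA; have := h4' _ vA.
  by rewrite /= !lerN2 => -> -> -> ->.
have e1 : nw.1 = (sw.1.1, ne.1.2).
  have := h2 _ m1; have := h2' _ m4; have := box _ m2; rewrite /= lerN2.
  move: nw.1 => [a b] /= /andP[/andP[l1 _] /andP[_ l2]] l3 l4.
  by congr pair; apply/eqP; rewrite eq_le ?l1 ?l2 ?l3 ?l4.
have e2 : se.1 = (ne.1.1, sw.1.2).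
  have := h3 _ m4; have := h3' _ m1; have := box _ m3; rewrite /= lerN2.
  move: se.1 => [a b] /= /andP[/andP[_ l1] /andP[l2 _]] l3 l4.
  by congr pair; apply/eqP; rewrite eq_le ?l1 ?l2 ?l3 ?l4.
(* The neighbours forced by the east and north glues of [tSW] make both side lengths positive. *)
have o1 := cA (d := dE) m1; have o2 := cA (d := dN) m1.
rewrite t1 /= in o1 o2; have {o1}/domP[t o1] := o1 isT; have {o2}/domP[t' o2] := o2 isT.
have := box _ o1; have := box _ o2; have := box _ m4.
case: sw t1 m1 {h1 h1'} box e1 e2 {o1 o2} => [[x y] tt] /= -> m1 box e1 e2.
case: ne t4 m4 {h4 h4'} box e1 e2 => [[x' y'] tt'] /= -> m4 box e1 e2.
case: nw t2 m2 {h2 h2'} e1 => [q1 tt1] /= -> m2 e1.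
case: se t3 m3 {h3 h3'} e2 => [q2 tt2] /= -> m3 e2.
subst q1 q2 => /andP[/andP[l1 _] /andP[l2 _]] /andP[_ /andP[_ l3]] /andP[/andP[_ l4] _].
exists (x, y), `|x' - x|%N, `|y' - y|%N => /=.
have -> : (x + `|x' - x|%N)%R = x' by clear -l1; plia.
have -> : (y + `|y' - y|%N)%R = y' by clear -l2; plia.
split=> //; clear -l1 l2 l3 l4; plia.
Qed.

Variables (p : pos) (n m : nat).
Hypothesis swA : (p, tSW) \in A.
Hypothesis nwA : ((p.1, p.2 + m%:Z)%R, tNW) \in A.
Hypothesis seA : ((p.1 + n%:Z, p.2)%R, tSE) \in A.
Hypothesis neA : ((p.1 + n%:Z, p.2 + m%:Z)%R, tNE) \in A.
Hypotheses (n0 : 0 < n) (m0 : 0 < m).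
Hypothesis box : forall v, v \in A ->
  (p.1 <= v.1.1 <= p.1 + n%:Z)%R && (p.2 <= v.1.2 <= p.2 + m%:Z)%R.

Lemma rect_W v : v \in A -> v.2 \in [:: tW; tNW] -> v.1.1 = p.1.
Proof. exact: (walk_keepsP wA conA sA (r := (p, tSW)) tabSW_ok keepSW_x swA). Qed.

Lemma rect_S v : v \in A -> v.2 \in [:: tS; tSE] -> v.1.2 = p.2.
Proof. exact: (walk_keepsP wA conA sA (r := (p, tSW)) tabSW_ok keepSW_y swA). Qed.

Lemma rect_F v : v \in A -> v.2 \in [:: tF; tNE] -> v.1.1 = (p.1 + n%:Z)%R.
Proof. exact: (walk_keepsP wA conA sA (r := (_, tSE)) tabSE_ok keepSE_x seA). Qed.

Lemma rect_SE v : v \in A -> v.2 = tSE -> v.1 = (p.1 + n%:Z, p.2)%R.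
Proof. by move=> vA e; rewrite (uniq_tile wA conA (t := tSE) isT sA vA seA). Qed.

Lemma rect_SW v : v \in A -> v.2 = tSW -> v.1 = p.
Proof. by move=> vA e; rewrite (uniq_tile wA conA (t := tSW) isT sA vA swA). Qed.

Lemma rect_NW v : v \in A -> v.2 = tNW -> v.1 = (p.1, p.2 + m%:Z)%R.
Proof. by move=> vA e; rewrite (uniq_tile wA conA (t := tNW) isT sA vA nwA). Qed.

Definition body := [:: tSW; tW; tNW; tS; tSE; tC; tF; tNE].

(** The hair lies in the row of [tNE], the top row, and its north glue asks for a tile above the
    box. *)
Lemma rect_noH v : v \in A -> v.2 <> tH.
Proof.
move=> vA e; have : v.1.2 = (p.2 + m%:Z)%R.
  by apply: (walk_keepsP wA conA sA (r := (_, tNE)) tabNE_ok keepNE_y neA vA); rewrite e.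
have := @cA v dN vA; rewrite e => /(_ isT) /domP[t /box] /=; plia.
Qed.

Lemma rect_body v : v \in A -> v.2 \in body.
Proof.
have sA' u : u \in A -> u.2 \in rem tH combs.
  move=> uA; have := sA uA; have := rect_noH uA => /eqP.
  by rewrite /= !inE => /negbTE->.
(* Once [tH] is excluded, walks from [tNE] no longer reach [tI]. *)
pose l := [:: (tF, dS); (tSE, dS); (tS, dW); (tSW, dW); (tW, dN); (tNW, dN); (tC, dE)].
have W : walk_table (rem tH combs) tNE l by vm_compute.
pose ne : ptile := ((p.1 + n%:Z, p.2 + m%:Z)%R, tNE).
move=> vA; have [->//|[d]] := walk_tableP wA conA sA' (r := ne) W neA vA.
case/hasP=> x xl /andP[/eqP <- _].
exact: (allP (isT : all (fun x => x.1 \in body) l)).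
Qed.

Lemma rect_left v : v \in A -> (v.1.1 < p.1 + n%:Z)%R -> v.2 \in [:: tSW; tW; tNW; tS; tC].
Proof.
move=> vA lt; have := rect_body vA.
have F : v.2 \notin [:: tF; tNE].
  by apply/negP=> /(rect_F vA) e; rewrite e ltxx in lt.
have E : v.2 != tSE by apply/eqP=> /(rect_SE vA) e; rewrite e ltxx in lt.
by move: F; rewrite !inE negb_or => /andP[/negbTE-> /negbTE->]; rewrite (negbTE E) !orbF /=.
Qed.

Lemma rect_right v : v \in A -> v.1.1 = (p.1 + n%:Z)%R -> v.2 \in [:: tSE; tF; tNE].
Proof.
move=> vA e; have h := rect_body vA.
have /implyP : (v.2 \notin [:: tSE; tF; tNE]) ==> (4 <= gstr (gl dE v.2)).
  by move: v.2 h; apply/allP.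
case: (boolP (v.2 \in _)) => // _ /(_ isT) /(cA vA) /domP[t /box] /=; plia.
Qed.

Lemma rect_left0 v : v \in A -> v.1.1 = p.1 -> v.2 \in [:: tSW; tW; tNW].
Proof.
move=> vA e; have h : v.2 \in [:: tSW; tW; tNW; tS; tC] by apply: (rect_left vA); plia.
have /implyP : (v.2 \notin [:: tSW; tW; tNW]) ==> (4 <= gstr (gl dW v.2)).
  by move: v.2 h; apply/allP.
case: (boolP (v.2 \in _)) => // _ /(_ isT) /(cA vA) /domP[t /box] /=; plia.
Qed.

(** West of the last column every remaining type has a strong east glue, so a row started on the
    spine continues to the last column. *)
Lemma rect_row y i : i <= n -> (p.1, y) \in dom A -> ((p.1 + i%:Z)%R, y) \in dom A.
Proof.
move=> + yA; elim: i => [|i IH] hi; first by rewrite addr0.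
have /domP[t tA] := IH (ltnW hi).
have /(cA tA) : 4 <= gstr (gl dE t).
  have : t \in [:: tSW; tW; tNW; tS; tC] by apply: (rect_left tA) => /=; plia.
  by move: t {tA}; apply/allP.
by rewrite /= -addrA -natz -[1%R]/(1%:R)%R -natrD addn1 natz.
Qed.

Lemma rect_col j : j <= m -> (p.1, p.2 + j%:Z)%R \in dom A.
Proof.
elim: j => [|j IH] hj; first by rewrite addr0 -surjective_pairing; apply: (dom_mem swA).
have /domP[t tA] := IH (ltnW hj).
have tN : t != tNW by apply/eqP=> /(rect_NW tA) /= [] ; plia.
have /(cA tA) : 4 <= gstr (gl dN t).
  have := rect_left0 tA erefl; rewrite /= !inE (negbTE tN) orbF.
  by case/orP=> /eqP->.
by rewrite /= -addrA -natz -[1%R]/(1%:R)%R -natrD addn1 natz.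
Qed.

Lemma rect_dom q : (q \in dom A) =
  (p.1 <= q.1 <= p.1 + n%:Z)%R && (p.2 <= q.2 <= p.2 + m%:Z)%R.
Proof.
apply/idP/idP => [/domP[t /box]//|].
case: q => x y /= /andP[/andP[h1 h2] /andP[h3 h4]].
have -> : x = (p.1 + `|x - p.1|%N%:Z)%R by plia.
have -> : y = (p.2 + `|y - p.2|%N%:Z)%R by plia.
by apply: rect_row; [plia|apply: rect_col; plia].
Qed.

Lemma rect_C v : v \in A -> (p.1 < v.1.1 < p.1 + n%:Z)%R -> (p.2 < v.1.2)%R -> v.2 = tC.
Proof.
move=> vA /andP[h1 h2] h3; have := rect_left vA h2; rewrite !inE.
case/orP=> [/eqP/(rect_SW vA) e|]; first by rewrite e ltxx in h1.
have W : v.2 \notin [:: tW; tNW] by apply/negP=> /(rect_W vA) e; rewrite e ltxx in h1.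
have S : v.2 \notin [:: tS; tSE] by apply/negP=> /(rect_S vA) e; rewrite e ltxx in h3.
move: W S; rewrite !inE !negb_or => /andP[/negbTE-> /negbTE->] /andP[/negbTE-> _].
by move/eqP.
Qed.

Lemma rect_Fcol v : v \in A -> v.1.1 = (p.1 + n%:Z)%R -> (p.2 < v.1.2)%R ->
  v.2 \in [:: tF; tNE].
Proof.
move=> vA h h3; have := rect_right vA h; rewrite !inE.
by case/orP=> [/eqP/(rect_SE vA) e|//]; rewrite e ltxx in h3.
Qed.

(** * Large rectangles break, small ones accept a bar *)

Lemma size_positions (X : assembly) (l : seq pos) : uniq l -> {subset l <= dom X} ->
  size l <= size X.
Proof. by move=> ul s; rewrite -(size_map fst X); apply: uniq_leq_size. Qed.

(** The cut strength is at most that of the only crossing bond, and contracting the tooth [X] shows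
    that the rest stays connected. *)
Lemma can_break_tooth k (X : pred ptile) x r :
  (forall u v, u \in A -> v \in A -> X u -> ~~ X v -> 0 < bond u v -> u = x /\ v = r) ->
  connected gstr (filter X A) -> filter X A != [::] ->
  filter (predC X) A != [::] ->
  bond x r < temp k (minn (size (filter X A)) (size (filter (predC X) A))) ->
  can_break gstr (temp k) A.
Proof.
move=> H cX X0 Y0 lt; have U := union_sym (union_filterC X wA).
exists (filter X A), (filter (predC X) A); split=> //; split=> //; split=> //.
split=> //; split.
  apply: (connected_leaf conA (union_sym U) (u0 := r)) => u v.
  rewrite !mem_filter => /andP[nu uA] /andP[Xv vA]; rewrite bstr_sym => b.
  by have [] := H _ _ vA uA Xv nu b.
apply: leq_ltn_trans lt.
rewrite -(big_seq1 addn (x, r) (fun e => bond e.1 e.2)).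
apply: cut_ub; rewrite ?filter_uniq ?wf_uniq // => u v.
rewrite !mem_filter => /andP[Xu uA] /andP[nv vA] b.
by have [-> ->] := H _ _ uA vA Xu nv b; rewrite mem_head.
Qed.

(** The top row between its two end columns hangs on [tNW] by strength 4 and has [n - 1 >= k - 1]
    tiles, where the temperature is at least 5. *)
Lemma break_row k : k <= n -> 2 < k -> can_break gstr (temp k) A.
Proof.
move=> kn k2.
pose X (v : ptile) := [&& (p.1 < v.1.1)%R, (v.1.1 < p.1 + n%:Z)%R & v.1.2 == (p.2 + m%:Z)%R].
have XC v : v \in A -> X v -> v.2 = tC.
  by move=> vA /and3P[h1 h2 /eqP h3]; apply: rect_C; rewrite ?h1 ?h2 // h3; plia.
have inX x : (p.1 < x < p.1 + n%:Z)%R -> ((x, (p.2 + m%:Z)%R), tC) \in filter X A.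
  move=> h; have /domP[t tA] : (x, (p.2 + m%:Z)%R) \in dom A by rewrite rect_dom /=; plia.
  have Xt : X (x, (p.2 + m%:Z)%R, t) by rewrite /X /= eqxx; plia.
  by have /= et := XC _ tA Xt; rewrite mem_filter -{1}et Xt -et.
have sX : n.-1 <= size (filter X A).
  rewrite -(size_iota 0 n.-1) -(size_map (fun i => (p.1 + i.+1%:Z, p.2 + m%:Z)%R)).
  apply: size_positions.
    rewrite map_inj_in_uniq ?iota_uniq // => i j _ _ [].
    by move/addrI => [].
  move=> q /mapP[i]; rewrite mem_iota => h ->; apply/domP; exists tC; apply: inX; plia.
(* The bottom row alone makes the remainder large enough. *)
have sY : n <= size (filter (predC X) A).
  rewrite -(size_iota 0 n) -(size_map (fun i => (p.1 + i%:Z, p.2)%R)).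
  apply: size_positions.
    rewrite map_inj_in_uniq ?iota_uniq // => i j _ _ [].
    by move/addrI => [].
  move=> q /mapP[i]; rewrite mem_iota => h ->.
  have /domP[t tA] : ((p.1 + i%:Z)%R, p.2) \in dom A by rewrite rect_dom /=; plia.
  by apply/domP; exists t; rewrite mem_filter tA /X /= andbT; plia.
pose x : ptile := ((p.1 + 1, p.2 + m%:Z)%R, tC).
pose r : ptile := ((p.1, p.2 + m%:Z)%R, tNW).
have xX : x \in filter X A by apply: inX; plia.
apply: (can_break_tooth (X := X) (x := x) (r := r)).
- move=> u v uA vA Xu nXv /bond_glued[d [e g _]].
  have uC := XC _ uA Xu; case/and3P: (Xu) => h1 h2 /eqP h3.
  have [de|de] : d = dE \/ d = dW by move: g; rewrite uC => /andP[_]; case: (d) => // _; [left|right].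
    have ev : v.1 = (u.1.1 + 1, u.1.2)%R by rewrite e de.
    have vF : v.2 \in [:: tF; tNE].
      apply: rect_Fcol => //; last by rewrite ev /= h3; plia.
      by move: nXv; rewrite /X ev /= h3 eqxx; plia.
    by move: g vF; rewrite uC de /glued /= !inE => /andP[/eqP g _] /orP[] /eqP ev2; rewrite ev2 in g.
  have ev : v.1 = (u.1.1 - 1, u.1.2)%R by rewrite e de.
  have ex : u.1.1 = (p.1 + 1)%R.
    by move: nXv; rewrite /X ev /= h3 eqxx; plia.
  split; apply: (wf_inj wA) => //.
  + by move: xX; rewrite mem_filter => /andP[].
  + by rewrite (surjective_pairing u.1) ex h3.
  + by rewrite ev ex h3 /= addrK.
- apply: (connected_rank (r := x) (rk := fun v => `|v.1.1 - p.1|%N)) => // v.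
  rewrite mem_filter => /andP[Xv vA]; have vC := XC _ vA Xv.
  case/and3P: (Xv) => h1 h2 /eqP h3.
  case: (eqVneq v.1.1 (p.1 + 1)%R) => [e|ne].
    left; apply: (wf_inj wA) => //; first by move: xX; rewrite mem_filter => /andP[].
    by rewrite (surjective_pairing v.1) e h3.
  right; exists ((v.1.1 - 1, p.2 + m%:Z)%R, tC); split.
  + by apply: inX; plia.
  + rewrite /=; plia.
  + by rewrite (@glued_bond dE) ?vC //= (surjective_pairing v.1) h3 subrK.
- by apply/eqP=> e; rewrite e in xX.
- by apply/eqP=> e; move: sY; rewrite e /=; plia.
have -> : bond x r = 4 by rewrite (@glued_bond dW) //= addrK.
rewrite /temp; plia.
Qed.

(** The last column above [tSE] hangs by strength 5 and has [m >= k] tiles, where the temperature is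
    at least 6; the first column makes the remainder as large. *)
Lemma break_col k : k <= m -> 2 < k -> can_break gstr (temp k) A.
Proof.
move=> km k2.
pose X (v : ptile) := (v.1.1 == (p.1 + n%:Z)%R) && (p.2 < v.1.2)%R.
have XF v : v \in A -> X v -> v.2 \in [:: tF; tNE].
  by move=> vA /andP[/eqP h1 h2]; apply: rect_Fcol.
have inX y : (p.2 < y <= p.2 + m%:Z)%R ->
    exists2 t, t \in [:: tF; tNE] & (((p.1 + n%:Z)%R, y), t) \in filter X A.
  move=> h; have /domP[t tA] : ((p.1 + n%:Z)%R, y) \in dom A by rewrite rect_dom /=; plia.
  have Xt : X ((p.1 + n%:Z)%R, y, t) by rewrite /X /= eqxx; plia.
  by exists t; [apply: (XF _ tA Xt)|rewrite mem_filter Xt].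
have sX : m <= size (filter X A).
  rewrite -(size_iota 0 m) -(size_map (fun i => (p.1 + n%:Z, p.2 + i.+1%:Z)%R)).
  apply: size_positions.
    rewrite map_inj_in_uniq ?iota_uniq // => i j _ _ [].
    by move/addrI => [].
  move=> q /mapP[i]; rewrite mem_iota => h ->; apply/domP.
  by have [|t _ tX] := inX (p.2 + i.+1%:Z)%R; [plia|exists t].
have sY : m <= size (filter (predC X) A).
  rewrite -(size_iota 0 m) -(size_map (fun i => (p.1, p.2 + i%:Z)%R)).
  apply: size_positions.
    rewrite map_inj_in_uniq ?iota_uniq // => i j _ _ [].
    by move/addrI => [].
  move=> q /mapP[i]; rewrite mem_iota => h ->.
  have /domP[t tA] : (p.1, (p.2 + i%:Z)%R) \in dom A by rewrite rect_dom /=; plia.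
  by apply/domP; exists t; rewrite mem_filter tA /X /= andbT; plia.
have [|xt xtF xX] := inX (p.2 + 1)%R; first by plia.
set x : ptile := (_, xt) in xX.
pose r : ptile := ((p.1 + n%:Z, p.2)%R, tSE).
apply: (can_break_tooth (X := X) (x := x) (r := r)).
- move=> u v uA vA Xu nXv /bond_glued[d [e g _]].
  have uF := XF _ uA Xu; case/andP: (Xu) => /eqP h1 h2.
  have nN : d != dN.
    by apply: contraNneq nXv => de; rewrite /X e de /= h1 eqxx /=; plia.
  have uT : u.2 \in body by move: (u.2) uF; apply/allP.
  have de : d = dS.
    have := @all2_tilesP body (fun d t t' => glued d t t' ==> (t \in [:: tF; tNE]) ==>
      (d == dN) || (d == dS)) isT d _ _ uT (rect_body vA).
    by rewrite g uF (negbTE nN) /= => /eqP.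
  have ev : v.1 = (u.1.1, u.1.2 - 1)%R by rewrite e de.
  have eu : u.1.2 = (p.2 + 1)%R.
    by move: nXv; rewrite /X ev /= h1 eqxx /=; plia.
  split; apply: (wf_inj wA) => //.
  + by move: xX; rewrite mem_filter => /andP[].
  + by rewrite (surjective_pairing u.1) h1 eu.
  + by rewrite ev h1 eu /= addrK.
- apply: (connected_rank (r := x) (rk := fun v => `|v.1.2 - p.2|%N)) => // v.
  rewrite mem_filter => /andP[Xv vA]; have vF := XF _ vA Xv.
  case/andP: (Xv) => /eqP h1 h2.
  case: (eqVneq v.1.2 (p.2 + 1)%R) => [e|ne].
    left; apply: (wf_inj wA) => //; first by move: xX; rewrite mem_filter => /andP[].
    by rewrite (surjective_pairing v.1) e h1.
  have /andP[_ /andP[_ h3]] := box vA.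
  have [|t tF' tX] := inX (v.1.2 - 1)%R; first by plia.
  right; exists ((p.1 + n%:Z, v.1.2 - 1)%R, t); split=> //.
  + by rewrite /=; plia.
  + have tT : t == tF.
      move: tF'; rewrite !inE => /orP[//|/eqP et]; move: tX.
      rewrite mem_filter et => /andP[_ tX].
      have := uniq_tile wA conA (t := tNE) isT sA neA tX erefl erefl.
      by case=> ee; plia.
    rewrite (@glued_bond dN) /= ?(eqP tT) //.
      by rewrite (surjective_pairing v.1) h1 subrK.
    by move: vF; rewrite !inE => /orP[] /eqP->.
- by apply/eqP=> e; rewrite e in xX.
- by apply/eqP=> e; move: sY; rewrite e /=; plia.
have -> : bond x r = 5.
  rewrite (@glued_bond dS) //= ?addrK //; by move: xtF; rewrite !inE => /orP[] /eqP->.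
rewrite /temp; plia.
Qed.

(** Tiles are numbered along the bar: 0 is the foot west of [tSW], [m + 1] the corner beyond [tNW],
    and [n + m + 2] the foot above [tNE]. *)
Definition bar_at i : ptile :=
  (if i <= m.+1 then (p.1 - 1, p.2 + i%:Z)%R
   else (p.1 + i%:Z - m%:Z - 2, p.2 + m%:Z + 1)%R,
   if i == 0 then tXL else if i <= m then tK else if i == m.+1 then tQ
   else if i < n + m + 2 then tJ else tXR).

Definition bar := map bar_at (iota 0 (n + m + 3)).

(** The coordinate sum determines the index: this gives distinct positions and a rank for
    connectedness. *)
Lemma bar_sum i : ((bar_at i).1.1 + (bar_at i).1.2 = p.1 + p.2 - 1 + i%:Z)%R.
Proof. by rewrite /bar_at /=; case: ifP => _ /=; plia. Qed.

Lemma bar_inj i j : (bar_at i).1 = (bar_at j).1 -> i = j.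
Proof. by move=> e; have := bar_sum i; rewrite e bar_sum; plia. Qed.

Lemma bar_bond i : i.+1 < n + m + 3 -> 0 < bond (bar_at i) (bar_at i.+1).
Proof.
move=> hi; suff [d e g] : exists2 d, (bar_at i.+1).1 = mv d (bar_at i).1 &
    glued d (bar_at i).2 (bar_at i.+1).2.
  by rewrite (glued_bond e g); case/andP: g.
rewrite /bar_at; case: (leqP i m) => him.
  exists dN; rewrite (leqW him) ltnS him /=; first by congr pair; plia.
  case: (ltnP i m) => him'; rewrite ?eqSS; first by case: (i == 0).
  have -> : i = m by plia.
  by rewrite eqxx; case: (m == 0).
have -> : (i == 0) = false by plia.
have -> : (i.+1 <= m.+1) = false by plia.
have -> : (i.+1 <= m) = false by plia.
have -> : (i.+1 == m.+1) = false by plia.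
have -> : (i.+1 == 0) = false by [].
exists dE.
  case: (ltnP m.+1 i) => him'; first by rewrite /=; congr pair; plia.
  have -> : i = m.+1 by plia.
  by rewrite /=; congr pair; plia.
rewrite /=; case: (i =P m.+1) => [_|_]; first by case: ifP.
have -> : i < n + m + 2 by plia.
by case: ifP.
Qed.

Lemma bar_mem i : (bar_at i \in bar) = (i < n + m + 3).
Proof.
apply/mapP/idP => [[j] + e|h]; last by exists i; rewrite // mem_iota.
have -> : i = j by apply: bar_inj; rewrite e.
by rewrite mem_iota.
Qed.

Lemma bar_bars v : v \in bar -> v.2 \in bars.
Proof. by case/mapP=> i _ -> /=; do 4?case: ifP. Qed.

Lemma bar_wf : wf bar.
Proof. by rewrite /wf -map_comp map_inj_uniq ?iota_uniq // => i j /bar_inj. Qed.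

(** All bonds within the bar have strength at least 4, so it grows tile by tile. Its size
    [n + m + 3] is at most [2k], where the temperature is at most 6, the strength of both feet. *)
Lemma bar_attach k : n < k -> m < k -> n + m < (k.-1).*2 -> 2 < k ->
  exists2 d, producible gstr tiles (temp k) d & can_combine_with gstr (temp k) A d.
Proof.
move=> nk mk nmk k2; exists bar.
  have tB v : v \in bar -> v.2 \in tiles.
    by move=> /bar_bars vb; rewrite mem_cat vb orbT.
  apply: connected_producible.
  - exact: bar_wf.
  - by apply/eqP=> e; have := bar_mem 0; rewrite e in_nil; plia.
  - by move=> t /mapP[v vB ->]; apply: tB.
  - have b0 : bar_at 0 \in bar by rewrite bar_mem; plia.
    apply: (connected_rank (r := bar_at 0)
      (rk := fun v => absz (v.1.1 + v.1.2 - (p.1 + p.2 - 1))%R)) => // v.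
    case/mapP=> -[|i]; rewrite mem_iota => hi -> ; first by left.
    right; exists (bar_at i); split.
    + by rewrite bar_mem; plia.
    + by rewrite !bar_sum; plia.
    + by apply: bar_bond; plia.
  move=> u v uB vB b; rewrite temp1 //.
  by apply: bond_same (tB _ uB) (tB _ vB) b _; rewrite /isbar !bar_bars.
split.
  have := bar_wf; move: (wA); rewrite /wf map_cat cat_uniq => -> -> /=; rewrite andbT.
  apply/hasPn => _ /mapP[v /mapP[i _ ->] ->]; rewrite -[map fst A]/(dom A) rect_dom.
  by rewrite /bar_at /=; case: ifP => _ /=; plia.
have := @cut_ge2 gstr A bar _ _ _ _ swA (_ : bar_at 0 \in bar) neA
  (_ : bar_at (n + m + 2) \in bar).
rewrite !bar_mem => K.
have b1 : bond (p, tSW) (bar_at 0) = 3.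
  by apply: (@bond_foot _ _ dW) => //=; rewrite addr0.
have b2 : bond ((p.1 + n%:Z, p.2 + m%:Z)%R, tNE) (bar_at (n + m + 2)) = 3.
  apply: (@bond_foot _ _ dN); rewrite /bar_at.
    rewrite ifF; last by plia.
    by rewrite /=; congr pair; plia.
  by rewrite /= !ifF //; plia.
rewrite b1 b2 in K.
apply: leq_trans (K _ _ _); [|plia|plia|by apply/eqP=> -[_]; rewrite /=; plia].
have : minn (size A) (size bar) <= k.*2.
  by rewrite size_map size_iota; plia.
rewrite /temp; plia.
Qed.

End Rectangle.

(** No row breaks off, so [n < k]; no column does, so [m < k]; no bar attaches, so
    [n + m >= 2(k - 1)]. Hence [n = m = k - 1]. *)
Lemma terminal_square k g : 2 < k -> terminal gstr tiles (temp k) g ->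
  exists p : pos, forall q, (q \in dom g) =
    (p.1 <= q.1 <= p.1 + k.-1%:Z)%R && (p.2 <= q.2 <= p.2 + k.-1%:Z)%R.
Proof.
move=> k2 tg; have cg := terminal_saturated k2 tg; case: tg => pg [nc nb].
have gg := producible_good pg; have g0 := producible_neq0 pg.
have e := saturated_comb gg cg g0.
have sg v : v \in g -> v.2 \in combs.
  move=> vg; have := good_typed gg vg; rewrite mem_cat => /orP[//|vb].
  by have : v \in part true g; [rewrite mem_part vg /isbar vb|rewrite e].
have wg := good_wf gg; have hg := good_conn gg.
have [p [n [m [[h1 h2 h3 h4] n0 m0 box]]]] := rect_corners wg hg g0 cg sg.
exists p => q; rewrite (rect_dom wg hg cg sg h1 h2 h3 h4 n0 m0 box).
have hn : n < k.
  rewrite ltnNge; apply/negP=> kn; apply: nb.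
  exact: (break_row wg hg cg sg h1 h2 h3 h4 n0 m0 box kn k2).
have hm : m < k.
  rewrite ltnNge; apply/negP=> km; apply: nb.
  exact: (break_col wg hg cg sg h1 h2 h3 h4 n0 m0 box km k2).
have hnm : (k.-1).*2 <= n + m.
  rewrite leqNgt; apply/negP=> lt.
  have [d pd cd] := bar_attach wg hg cg sg h1 h2 h3 h4 n0 m0 box hn hm lt k2.
  exact: nc cd.
have -> : n = k.-1 by lia.
by have -> : m = k.-1 by lia.
Qed.

(** * The k x k square is terminal *)

Section Square.
Variable n : nat.
Hypothesis n2 : 1 < n.
Implicit Types u v w : ptile.

Definition cell_type i j :=
  if i == 0 then (if j == 0 then tSW else if j == n then tNW else tW)
  else if j == 0 then (if i == n then tSE else tS)
  else if i == n then (if j == n then tNE else tF) else tC.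

Definition cell i j : ptile := ((i%:Z, j%:Z)%R, cell_type i j).

Definition sq : assembly := [seq cell i j | i <- iota 0 n.+1, j <- iota 0 n.+1].

Lemma sqP v : reflect (exists i j, [/\ i <= n, j <= n & v = cell i j]) (v \in sq).
Proof.
apply: (iffP allpairsP) => [[[i j] []]|[i [j [hi hj ->]]]].
  by rewrite !mem_iota => hi hj ->; exists i, j.
by exists (i, j); rewrite !mem_iota.
Qed.

Lemma cell_sq i j : i <= n -> j <= n -> cell i j \in sq.
Proof. by move=> hi hj; apply/sqP; exists i, j. Qed.

Lemma sq_wf : wf sq.
Proof.
rewrite /wf map_allpairs; apply: allpairs_uniq; rewrite ?iota_uniq //.
by move=> [i j] [i' j'] _ _ [-> ->].
Qed.

Lemma sq_size : size sq = n.+1 * n.+1.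
Proof. by rewrite size_allpairs !size_iota. Qed.

Lemma cell_body i j : cell_type i j \in body.
Proof. by rewrite /cell_type; do 5?case: ifP. Qed.

Lemma sq_body v : v \in sq -> v.2 \in body.
Proof. by case/sqP=> i [j [_ _ ->]]; apply: cell_body. Qed.

Lemma sq_typed : typed sq.
Proof. by move=> v /sq_body; apply: (allP (isT : all (fun t => t \in tiles) body)). Qed.

Lemma sq_comb v : v \in sq -> isbar v = false.
Proof. by move=> /sq_body h; apply/negbTE; apply: (allP (isT : all (fun t => t \notin bars) body)) h. Qed.

Lemma sq_bond u v : u \in sq -> v \in sq -> 0 < bond u v -> 4 <= bond u v.
Proof.
by move=> uS vS b; apply: bond_same; rewrite ?sq_comb //; apply: sq_typed.
Qed.

(** Spanning tree rooted at [cell 0 0]: the parent is the cell below in the first column and, above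
    the bottom row, in the last column; elsewhere it is the cell to the west. *)
Lemma cell_parent i j : i <= n -> j <= n -> 0 < i + j ->
  exists i' j', [/\ i' <= n, j' <= n, i' + j' < i + j & 0 < bond (cell i' j') (cell i j)].
Proof.
move=> hi hj ij.
suff [i' [j' [d [h1 h2 h3 e g]]]] : exists i' j' d, [/\ i' <= n, j' <= n, i' + j' < i + j,
    (cell i j).1 = mv d (cell i' j').1 & glued d (cell_type i' j') (cell_type i j)].
  exists i', j'; split=> //; rewrite (@glued_bond d) //.
  by case/andP: g.
case: (boolP ((i == 0) || (i == n) && (j != 0))) => h.
  exists i, j.-1, dN; split; try lia; first by rewrite /=; congr pair; lia.
  rewrite /cell_type; case/orP: h => [i0|/andP[i0 j0]].
    have j0 : (j == 0) = false by lia.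
    rewrite i0 j0; have -> : (j.-1 == n) = false by lia.
    by case: (j.-1 == 0); case: (j == n).
  have -> : (i == 0) = false by lia.
  rewrite i0 (negbTE j0); have -> : (j.-1 == n) = false by lia.
  by case: (j.-1 == 0); case: (j == n).
exists i.-1, j, dE; split; try lia; first by rewrite /=; congr pair; lia.
rewrite /cell_type.
have -> : (i == 0) = false by lia.
have -> : (i.-1 == n) = false by lia.
case: (j =P 0) => j0; first by case: (i.-1 == 0); case: (i == n).
have -> : (i == n) = false by lia.
by case: (i.-1 == 0); case: (j == n).
Qed.

Lemma sq_connected : connected gstr sq.
Proof.
apply: (connected_rank (r := cell 0 0) (rk := fun v => absz (v.1.1 + v.1.2)%R)).
  exact: cell_sq.
move=> v /sqP[i [j [hi hj ->]]]; case: (posnP (i + j)) => [e|ij].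
  by left; have [-> ->] : i = 0 /\ j = 0 by lia.
right; have [i' [j' [hi' hj' lt b]]] := cell_parent hi hj ij.
by exists (cell i' j'); split; [exact: cell_sq| rewrite /=; lia|].
Qed.

Lemma sq_producible k : 2 < k -> producible gstr tiles (temp k) sq.
Proof.
move=> k2; apply: connected_producible.
- exact: sq_wf.
- by apply/eqP=> e; have := cell_sq (leq0n n) (leq0n n); rewrite e.
- by move=> t /mapP[v vS ->]; apply: sq_typed.
- exact: sq_connected.
- by move=> u v uS vS b; rewrite temp1 //; apply: sq_bond.
Qed.

Lemma sq_C v : v \in sq -> v.2 = tC -> (0 < v.1.1 < n%:Z)%R.
Proof.
case/sqP=> i [j [hi hj ->]] /=; rewrite /cell_type.
case: (i =P 0) => i0; first by case: ifP => // _; case: ifP.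
case: (i =P n) => iN; first by do 3?case: ifP.
by move=> _; lia.
Qed.

Lemma sq_F v : v \in sq -> v.2 \in [:: tF; tNE] -> v.1.1 = Posz n /\ (0 < v.1.2 <= n%:Z)%R.
Proof.
case/sqP=> i [j [hi hj ->]] /=; rewrite /cell_type.
case: (i =P 0) => i0; first by do 2?case: ifP.
case: (j =P 0) => j0; first by case: ifP.
by case: (i =P n) => iN // _; lia.
Qed.

(* A piece hanging on the square by a single bond of strength less than 7 lies inside
   one row of tiles tC, respectively inside the column of tiles tF and tNE. *)
Lemma sq_piece X Y u v d : union_of sq Y X -> connected gstr X ->
  u \in Y -> v \in X -> v.1 = mv d u.1 ->
  d = dE /\ v.2 = tC \/ d = dN /\ v.2 \in [:: tF; tNE] ->
  size X <= if d == dE then n.-1 else n.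
Proof.
move=> U cX uY vX e h.
have XS w : w \in X -> w \in sq by apply: union_memR U.
have wX := union_wfR U.
have eu : u.1 = mv (opp d) v.1 by rewrite e mv_oppK.
have nou w : w \in X -> w.1 <> mv (opp d) v.1.
  by move=> wX' ew; apply: (union_disj U uY wX'); rewrite ew.
case: h => -[de vt]; rewrite de in nou *; rewrite /=.
  (* A walk from [v] cannot return to the cell of [u], and apart from westward bonds a [tC] bonds
     only to a [tC] on its east, so every walk keeps heading east. *)
  pose R d (w : ptile) := [/\ d = dE, w.2 = tC & w.1.2 = v.1.2].
  have step w d' w' : w \in X -> w.2 = tC -> w.1.2 = v.1.2 -> d' <> dW -> w' \in X ->
      w'.1 = mv d' w.1 -> 0 < bond w w' -> R d' w'.
    move=> wX' wt wy nd wX'' ew b; have := bond_mv ew b.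
    have := sq_body (XS _ wX''); rewrite wt => tb g.
    have := @all2_tilesP body (fun d t t' => glued d t t' ==> (t == tC) ==>
      ((d == dE) && (t' == tC)) || (d == dW)) isT d' tC w'.2 isT tb.
    rewrite g eqxx /= => /orP[/andP[/eqP de' /eqP tt]|/eqP//].
    by split=> //; rewrite ew de'.
  have K w : w \in X -> w.2 = tC /\ w.1.2 = v.1.2.
    move=> wX'; have [->//|[d' [_ ? ?]]//] : w = v \/ exists d, R d w.
    apply: (connected_inv (R := R) wX cX vX) wX' => [d' w' w'X ew b|].
      by apply: (step v) (ew) b => // dd; apply: (nou _ w'X); rewrite ew dd.
    move=> d1 w1 d2 w2 w1X [-> t1 y1] nd w2X e2 b; exact: (step w1) e2 b.
  rewrite -(size_map fst X) -(size_iota 1 n.-1) -(size_map (fun i => (i%:Z, v.1.2)%R)).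
  apply: uniq_leq_size => // q /mapP[w wX' ->]; have [wt wy] := K _ wX'.
  have aux (x : int) : (0 < x < n%:Z)%R -> (0 < `|x|%N < 1 + n.-1) && (x == Posz `|x|%N).
    by clear -n2; lia.
  have /andP[p1 /eqP p2] := aux _ (sq_C (XS _ wX') wt).
  apply/mapP; exists `|w.1.1|%N; first by rewrite mem_iota.
  by rewrite (surjective_pairing w.1) wy {1}p2.
pose R d (w : ptile) := d = dN /\ w.2 \in [:: tF; tNE].
have step w d' w' : w \in X -> w.2 \in [:: tF; tNE] -> d' <> dS -> w' \in X ->
    w'.1 = mv d' w.1 -> 0 < bond w w' -> R d' w'.
  move=> wX' wt nd wX'' ew b; have := bond_mv ew b.
  have := sq_body (XS _ wX''); have := sq_body (XS _ wX') => tb tb' g.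
  have := @all2_tilesP body (fun d t t' => glued d t t' ==> (t \in [:: tF; tNE]) ==>
    ((d == dN) && (t' \in [:: tF; tNE])) || (d == dS)) isT d' w.2 w'.2 tb tb'.
  by rewrite g wt /= => /orP[/andP[/eqP de' tt]|/eqP//].
have K w : w \in X -> w.2 \in [:: tF; tNE].
  move=> wX'; have [->//|[d' [_ ?]]//] : w = v \/ exists d, R d w.
  apply: (connected_inv (R := R) wX cX vX) wX' => [d' w' w'X ew b|].
    by apply: (step v) (ew) b => // dd; apply: (nou _ w'X); rewrite ew dd.
  move=> d1 w1 d2 w2 w1X [-> t1] nd w2X e2 b; exact: (step w1) e2 b.
rewrite -(size_map fst X) -[leqRHS](size_iota 1 n) -(size_map (fun i => (n%:Z, i%:Z)%R)).
apply: uniq_leq_size => // q /mapP[w wX' ->].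
have aux (x : int) : (0 < x <= n%:Z)%R -> (0 < `|x|%N < 1 + n) && (x == Posz `|x|%N).
  by clear -n2; lia.
have [e1 /aux/andP[p1 /eqP p2]] := sq_F (XS _ wX') (K _ wX').
apply/mapP; exists `|w.1.2|%N; first by rewrite mem_iota.
by rewrite (surjective_pairing w.1) e1 {1}p2.
Qed.

(** Let [k = n + 1]. A crossing bond of strength 7 meets every temperature. Otherwise a row bond of
    strength 4 crosses and one side has at most [k - 2] tiles, with temperature 4, or a column bond
    of strength 5 crosses and one side has at most [k - 1] tiles, with temperature at most 5. *)
Lemma sq_stable : ~ can_break gstr (temp n.+1) sq.
Proof.
move=> [a [b [U [a0 [b0 [ca [cb lt]]]]]]].
have [u [v [uA vB h]]] := connected_cross sq_connected U a0 b0.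
have [d [e g eb]] := bond_glued h.
have ge := cut_ge1 gstr uA vB.
have uS := union_memL U uA; have vS := union_memR U vB.
have := @all2_tilesP body (fun d t t' => glued d t t' ==>
   [|| 7 <= gstr (gl d t), [&& d == dE, t' == tC & 4 <= gstr (gl d t)],
       [&& d == dW, t == tC & 4 <= gstr (gl d t)],
       [&& d == dN, t' \in [:: tF; tNE] & 5 <= gstr (gl d t)] |
       [&& d == dS, t \in [:: tF; tNE] & 5 <= gstr (gl d t)]]) isT d _ _ (sq_body uS) (sq_body vS).
rewrite g -eb /=.
have e' : u.1 = mv (opp d) v.1 by rewrite e mv_oppK.
move: lt ge; rewrite /temp => lt ge.
case/or4P=> [s7|/and3P[/eqP de /eqP t s]|/and3P[/eqP de /eqP t s]|/orP[]/and3P[/eqP de t s]].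
- by lia.
- have := sq_piece U cb uA vB e (or_introl (conj de t)); rewrite de /=; lia.
- have := sq_piece (union_sym U) ca vB uA e'; rewrite de /= => K.
  have := K (or_introl (conj erefl t)); lia.
- have := sq_piece U cb uA vB e (or_intror (conj de t)); rewrite de /=; lia.
- have := sq_piece (union_sym U) ca vB uA e'; rewrite de /= => K.
  have := K (or_intror (conj erefl t)); lia.
Qed.

(** Outward glues on the border of the square have strength 0, except for the west glue of [tSW] and
    the north glue of [tNE]. *)
Lemma sq_border u v d t : u \in sq -> v = (mv d u.1, t) -> v.1 \notin dom sq ->
  glued d u.2 t ->
  [/\ u = cell 0 0, v.1 = (- 1, 0)%R & gstr (gl d u.2) = 3] \/
  [/\ u = cell n n, v.1 = (n%:Z, n%:Z + 1)%R & gstr (gl d u.2) = 3].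
Proof.
case/sqP=> i [j [hi hj ->]] -> /= nd g.
have no i' j' : mv d (i%:Z, j%:Z)%R = (i'%:Z, j'%:Z)%R -> (i' <= n) && (j' <= n) -> False.
  move=> ee /andP[hi' hj']; case/negP: nd; rewrite ee.
  exact: (dom_mem (cell_sq hi' hj')).
case/andP: g => _ ; case: d no {nd} => /= no.
- have -> : i = n.
    by apply/eqP; apply: contraT => ne; case: (no i.+1 j); [congr pair|]; lia.
  rewrite /cell_type eqxx; have -> : (n == 0) = false by lia.
  by do 2?case: ifP.
- have -> : i = 0.
    by apply/eqP; apply: contraT => ne; case: (no i.-1 j); [congr pair|]; lia.
  rewrite /cell_type eqxx; case: (j =P 0) => [->|_]; last by case: ifP.
  by left; split.
- have -> : j = n.
    by apply/eqP; apply: contraT => ne; case: (no i j.+1); [congr pair|]; lia.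
  rewrite /cell_type; have -> : (n == 0) = false by lia.
  rewrite eqxx; case: ifP => // _; case: (i =P n) => [->|_] // _.
  by right; split=> //; rewrite /cell_type.
- have -> : j = 0.
    by apply/eqP; apply: contraT => ne; case: (no i j.-1); [congr pair|]; lia.
  by rewrite /cell_type eqxx; do 2?case: ifP.
Qed.

(** One foot is too weak, so [d] occupies both foot cells. Their coordinate sums differ by [2n + 2],
    so the connected [d] has more than [2(n + 1)] tiles, as has the square; the temperature is then
    7, above 3 + 3. *)
Lemma sq_alone d : producible gstr tiles (temp n.+1) d ->
  ~ can_combine_with gstr (temp n.+1) sq d.
Proof.
move=> pd [w c]; have gd := producible_good pd.
have U : union_of (sq ++ d) sq d by [].
have wd := good_wf gd.
have s0 : size sq > 2 * n.+1 by rewrite sq_size; nia.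
have cross u v : u \in sq -> v \in d -> 0 < bond u v ->
    (u = cell 0 0 /\ v.1 = (- 1, 0)%R \/ u = cell n n /\ v.1 = (n%:Z, n%:Z + 1)%R)
    /\ bond u v = 3.
  move=> uS vd /bond_glued[dd [e g ->]].
  have nv : v.1 \notin dom sq.
    by apply/negP=> /mapP[x xS ex]; apply: (union_disj U xS vd).
  have := sq_border (v := v) (d := dd) (t := v.2) uS _ nv g.
  rewrite -e -surjective_pairing => /(_ erefl).
  by case=> -[? ? ?]; split=> //; [left|right].
have cut_small (E : seq (ptile * ptile)) :
    (forall u v, u \in sq -> v \in d -> 0 < bond u v -> (u, v) \in E) ->
    all (fun e => bond e.1 e.2 == 3) E -> cut_str gstr sq d <= 3 * size E.
  move=> H /allP E3; apply: leq_trans (cut_ub (wf_uniq sq_wf) (wf_uniq wd) H) _.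
  rewrite -sum1_size big_distrr /= leq_eqVlt; apply/orP; left; apply/eqP.
  by apply: eq_big_seq => e /E3 /eqP ->.
have lo := temp_bounds n.+1 (minn (size sq) (size d)).
have c4 : 4 <= cut_str gstr sq d by lia.
(* For a fixed tile and cell there is at most one bonded pair, and none when the cell is free. *)
have at_most u0 q : u0 \in sq -> exists E : seq (ptile * ptile),
    [/\ forall v, v \in d -> v.1 = q -> 0 < bond u0 v -> (u0, v) \in E,
        all (fun e => bond e.1 e.2 == 3) E, size E <= 1 & q \notin dom d -> E = [::]].
  move=> u0S; case: (boolP (q \in dom d)) => [/domP[t td]|qd]; last first.
    by exists [::]; split=> // v vd ev; case/negP: qd; rewrite -ev; apply: dom_mem.
  have ev v : v \in d -> v.1 = q -> v = (q, t) by move=> vd e; apply: (wf_inj wd).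
  case: (posnP (bond u0 (q, t))) => [z|b].
    by exists [::]; split=> // v vd e; rewrite (ev _ vd e) z.
  exists [:: (u0, (q, t))]; split=> //; last first.
    by rewrite /= (proj2 (cross _ _ u0S td b)).
  by move=> v vd e _; rewrite (ev _ vd e) mem_head.
have c00 := cell_sq (leq0n n) (leq0n n); have cnn := cell_sq (leqnn n) (leqnn n).
have [E1 [m1 a1 s1 z1]] := at_most _ (- 1, 0)%R c00.
have [E2 [m2 a2 s2 z2]] := at_most _ (n%:Z, n%:Z + 1)%R cnn.
have := cut_small (E1 ++ E2); rewrite all_cat a1 a2 size_cat => /(_ _ isT) K.
have {}K : cut_str gstr sq d <= 3 * (size E1 + size E2).
  apply: K => u v uS vd b; rewrite mem_cat.
  have [[[eu ev]|[eu ev]] _] := cross _ _ uS vd b; rewrite eu in b *.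
    by rewrite m1.
  by rewrite m2 ?orbT.
have in1 : (- 1, 0)%R \in dom d.
  by apply: contraT => /z1 e; move: K; rewrite e /=; lia.
have in2 : (n%:Z, n%:Z + 1)%R \in dom d.
  by apply: contraT => /z2 e; move: K; rewrite e /=; lia.
case/domP: in1 => t1 d1; case/domP: in2 => t2 d2.
have := @connected_size gstr d _ _ (n + n + 2) (good_conn gd) d1 d2.
have -> : (n%:Z + (n%:Z + 1) = - 1 + 0 + (n + n + 2)%N%:Z)%R by lia.
move=> /(_ erefl); move: c; rewrite /temp; lia.
Qed.

Lemma sq_terminal : terminal gstr tiles (temp n.+1) sq.
Proof.
split; first exact: sq_producible.
by split; [exact: sq_alone|exact: sq_stable].
Qed.

End Square.

Theorem theorem3 :
  exists (str : glue -> nat) (T : seq tiletype),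
    forall k : nat, 7 <= k ->
      exists tau : nat -> nat,
        nondecreasing_fun tau /\
        exists x y : int, self_assembles str T tau (square k x y).
Proof.
exists gstr, tiles => k k7; exists (temp k); split; first exact: temp_mono.
exists 0%R, 0%R; split.
  exists (sq k.-1); have := @sq_terminal k.-1.
  by rewrite prednK; [apply; lia|lia].
move=> g tg; have [|p H] := terminal_square _ tg; first by lia.
(* [square k 0 0] starts at coordinate 1, so the south-west cell [p] is moved to (1, 1). *)
exists (1 - p.1, 1 - p.2)%R => q; rewrite H /square /=.
by apply/idP/idP; lia.
Qed.
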